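(* Let $\Lambda$ be the complement of a linear forest and let $\Gamma$ be a finite simple graph. If there is an injective group homomorphism $A(\Lambda) \hookrightarrow A(\Gamma)$, then $\Lambda \leq \Gamma$, i.e. there is a full embedding $\Lambda \to \Gamma$.
   Context: All graphs are simple. For a graph $\Gamma$, the right-angled Artin group is $A(\Gamma) = \langle V(\Gamma) \mid uv=vu \text{ whenever } \{u,v\}\in E(\Gamma)\rangle$. A graph embedding $\iota\colon \Lambda\to\Gamma$ is an injective map $V(\Lambda)\to V(\Gamma)$ sending adjacent vertices to adjacent vertices; it is full if it also sends non-adjacent vertices to non-adjacent vertices. We write $\Lambda \leq \Gamma$ if there is a full embedding $\Lambda\to\Gamma$. The path graph $P_n$ ($n\ge 1$) is the graph with vertices $x_1,\dots,x_n$ and edges $\{x_i,x_{i+1}\}$, $1\le i\le n-1$. A linear forest is a disjoint union of finitely many path graphs. The complement $\Lambda^c$ of a graph $\Lambda$ has vertex set $V(\Lambda)$, with two distinct vertices adjacent in $\Lambda^c$ iff they are non-adjacent in $\Lambda$. *)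

(* Defs.v *)
From Stdlib Require Import Relations.
From mathcomp Require Import all_boot.
Set Implicit Arguments. Unset Strict Implicit. Unset Printing Implicit Defensive.

Definition simple_graph (V : finType) (e : rel V) : Prop :=
  symmetric e /\ irreflexive e.

Definition compl_rel (V : finType) (e : rel V) : rel V :=
  fun x y => (x != y) && ~~ e x y.

(* Linear forest: a disjoint union of finitely many path graphs.  Each vertex x
   gets a path label [comp x] and a position [pos x] on that path; the pair is
   injective, positions on each path form an initial segment {0,..,m-1}, and
   edges are exactly between consecutive positions on the same path. *)
Definition linear_forest (V : finType) (e : rel V) : Prop :=
  exists (comp pos : V -> nat),
    injective (fun x => (comp x, pos x)) /\
    (forall x, 0 < pos x -> exists y, comp y = comp x /\ pos y = (pos x).-1) /\
    (forall x y, e x y = (comp x == comp y) && ((pos x == (pos y).+1) || (pos y == (pos x).+1))).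

Definition full_embedding (VL VG : finType) (eL : rel VL) (eG : rel VG) (f : VL -> VG) : Prop :=
  injective f /\ (forall x y, eG (f x) (f y) = eL x y).

Definition full_subgraph (VL VG : finType) (eL : rel VL) (eG : rel VG) : Prop :=
  exists f : VL -> VG, full_embedding eL eG f.

(* Right-angled Artin group A(V,e): words in letters (v, b) (b = true: v, b = false: v^-1)
   modulo the congruence generated by free reduction and commutation of adjacent generators. *)
Definition letter (V : Type) := (V * bool)%type.
Definition word (V : Type) := seq (letter V).

Inductive raag_step (V : finType) (e : rel V) : word V -> word V -> Prop :=
| raag_free (u w : word V) (v : V) (b : bool) :
    raag_step e (u ++ [:: (v, b); (v, ~~ b)] ++ w) (u ++ w)
| raag_comm (u w : word V) (a c : letter V) :
    e a.1 c.1 -> raag_step e (u ++ [:: a; c] ++ w) (u ++ [:: c; a] ++ w).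

Definition raag_eq (V : finType) (e : rel V) : relation (word V) :=
  clos_refl_sym_trans (word V) (raag_step e).

Definition word_inv (V : Type) (w : word V) : word V :=
  rev (map (fun l : letter V => (l.1, ~~ l.2)) w).

Definition word_subst (VL VG : Type) (g : VL -> word VG) (w : word VL) : word VG :=
  flatten (map (fun l : letter VL => if l.2 then g l.1 else word_inv (g l.1)) w).

(* g defines a group homomorphism A(Lambda) -> A(Gamma): images of adjacent
   generators commute (every homomorphism arises this way). *)
Definition raag_hom (VL VG : finType) (eL : rel VL) (eG : rel VG) (g : VL -> word VG) : Prop :=
  forall u v, eL u v -> raag_eq eG (g u ++ g v) (g v ++ g u).

Definition raag_hom_injective (VL VG : finType) (eL : rel VL) (eG : rel VG) (g : VL -> word VG) : Prop :=
  forall w1 w2 : word VL, raag_eq eG (word_subst g w1) (word_subst g w2) -> raag_eq eL w1 w2.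

Definition raag_embeds (VL VG : finType) (eL : rel VL) (eG : rel VG) : Prop :=
  exists g : VL -> word VG, raag_hom eL eG g /\ raag_hom_injective eL eG g.

(* Main.v *)
(** The Cayley graph of A(Gamma) is cut by walls, one for each class of parallel
   edges; the walls dual to the edges (p, pa) and (q, qb) cross iff a and b are
   adjacent and the conjugated letters p a p^-1 and q b q^-1 commute.  An element
   skewers a wall if it maps one of its halfspaces strictly into itself.  Every
   element is a product of conjugated letters whose walls it skewers, and if f and
   f' commute, then a wall skewered by f crosses a wall skewered by f' unless both
   walls are skewered by both elements.

   Given an embedding A(Lambda) -> A(Gamma), cut the walls of the images of the
   vertices into blocks, the connected components of the relation "do not cross".
   The image of each vertex is the product of its commuting parts in the blocks, so
   that a word with nontrivial image survives in some block.  For a path component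
   x_0, ..., x_(n-1) of the complement of Lambda we use a word that dies in each
   block where some x_i vanishes, or where a power of x_0 agrees with a power of
   another commuting generator (an iterated commutator, corrected for n = 3).  In a
   block where it survives, a shortest path of non-crossing walls from x_0 to
   x_(n-1) has at least n walls; its consecutive walls do not cross and all others
   do.  Isolated vertices are treated by elimination in a free abelian group.

   This yields walls in A(Gamma) that cross according to Lambda.  They are moved to
   the base point by induction on the total length of the words that lead to them.
   Let c be the first letter of such a word.  The walls not commuting with c lie on
   two sides of the wall of c, and walls on different sides do not cross; so they
   span a complete bipartite graph in the complement of Lambda, which is a linear
   forest, and one side has at most one wall and the other at most two.  One side is
   then translated by c^-1, or one wall is replaced by that of c, or the wall of c
   is inserted into the path. *)

Require Import Defs.
From Stdlib Require Import Relations Classical.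
From HB Require Import structures.
From mathcomp Require Import all_boot all_order all_algebra generic_quotient zify.
Set Implicit Arguments. Unset Strict Implicit. Unset Printing Implicit Defensive.

(** * Pilings and the word problem *)

Record sgraph := SGraph {
  vert :> finType;
  adj : rel vert;
  adj_sym : symmetric adj;
  adj_irr : irreflexive adj }.
Arguments adj {s}.

Definition linv (V : Type) (a : letter V) : letter V := (a.1, ~~ a.2).

Lemma linvK (V : Type) : involutive (@linv V).
Proof. by case=> v b; rewrite /linv /= negbK. Qed.

Lemma linv_neq (V : eqType) (a : letter V) : (linv a == a) = false.
Proof. by case: a => v b; rewrite /linv xpair_eqE eqxx; case: b. Qed.

Section Pilings.
Variable g : sgraph.
Local Notation letter := (letter g).
Local Notation word := (word g).
Implicit Types (a b c : letter) (u w y : word).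

(* The stack over the vertex [v] records the letters of the word that do not
   commute with [v]: signs for the letters [v], [None] for the other ones. *)
Definition piling := {ffun g -> seq (option bool)}.
Implicit Types p q : piling.

Definition pil0 : piling := [ffun => [::]].

Definition push a p : piling :=
  [ffun v => if v == a.1 then Some a.2 :: p v
             else if adj a.1 v then p v else None :: p v].

Definition pop a p : piling :=
  [ffun v => if adj a.1 v then p v else behead (p v)].

Definition starts a p := ohead (p a.1) == Some (Some a.2).

Definition pact a p := if starts (linv a) p then pop a p else push a p.

(** These are the pilings of reduced words. On them [pact a] undoes [pact (linv a)], because a
    letter that a valid piling starts with can be removed as its last push. *)
Inductive valid : piling -> Prop :=
| valid0 : valid pil0
| valid_push a p : valid p -> ~~ starts (linv a) p -> valid (push a p).

Lemma starts0 a : starts a pil0 = false.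
Proof. by rewrite /starts ffunE. Qed.

Lemma starts_push a c p :
  starts a (push c p) = (a == c) || adj a.1 c.1 && starts a p.
Proof.
rewrite /starts ffunE; case: a c => v x [w z] /=.
case: (eqVneq v w) => [<-|vw] /=.
  by rewrite xpair_eqE eqxx adj_irr orbF /=; case: x; case: z.
by rewrite xpair_eqE (negbTE vw) adj_sym; case: ifP.
Qed.

Lemma pop_push a p : pop a (push a p) = p.
Proof.
apply/ffunP => v; rewrite !ffunE.
have [->|_] := eqVneq v a.1; first by rewrite adj_irr.
by case: (adj a.1 v).
Qed.

Lemma push_comm a c p : adj a.1 c.1 -> push a (push c p) = push c (push a p).
Proof.
move=> ac; apply/ffunP => v; rewrite !ffunE.
have [-> {v}|va] := eqVneq v a.1.
  by rewrite [adj c.1 _]adj_sym ac; case: eqP => // e; rewrite e adj_irr in ac.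
by have [->|vc] := eqVneq v c.1; rewrite ?ac //; case: ifP; case: ifP.
Qed.

(** A letter on top of its own stack is adjacent to all letters pushed after it, so its push can be
    moved past them to the end. *)
Lemma valid_starts a p : valid p -> starts a p ->
  exists2 q, valid q /\ ~~ starts (linv a) q & p = push a q.
Proof.
move=> vp; elim: vp a => [|c q vq IH nq] a; first by rewrite starts0.
rewrite starts_push => /orP[/eqP->|/andP[ac sq]]; first by exists q.
have [r [vr nr] eq_q] := IH a sq; exists (push c r); last by rewrite eq_q push_comm // adj_sym.
split; last by rewrite starts_push (negbTE nr) andbF orbF; apply: contraL ac => /eqP <-; rewrite adj_irr.
apply: valid_push => //; move: nq; rewrite eq_q starts_push negb_or => /andP[_].
by rewrite /= adj_sym ac.
Qed.

Lemma valid_act a p : valid p -> valid (pact a p).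
Proof.
move=> vp; rewrite /pact; case: ifP => [/valid_starts[]// q [vq _] ->|/negbT]; last exact: valid_push.
by rewrite -[pop a _]/(pop (linv a) _) pop_push.
Qed.

Lemma pact_push a p : pact a (push (linv a) p) = p.
Proof. by rewrite /pact starts_push eqxx /= -[pop a _]/(pop (linv a) _) pop_push. Qed.

Lemma pact_free a p : ~~ starts (linv a) p -> pact a p = push a p.
Proof. by rewrite /pact => /negbTE->. Qed.

Lemma pactK a p : valid p -> pact a (pact (linv a) p) = p.
Proof.
move=> vp; have [sp|np] := boolP (starts a p).
  have [q [vq nq] ->] := valid_starts vp sp.
  have -> : pact (linv a) (push a q) = q by rewrite -{2}[a]linvK pact_push.
  exact: pact_free.
by rewrite (@pact_free (linv a)) ?linvK // pact_push.
Qed.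

Lemma pact_comm a c p : valid p -> adj a.1 c.1 ->
  pact a (pact c p) = pact c (pact a p).
Proof.
move=> vp ac; have ca : adj c.1 a.1 by rewrite adj_sym.
have neq (b d : letter) : adj b.1 d.1 -> (linv b == d) = false.
  by move=> bd; apply: contraTF bd => /eqP <-; rewrite adj_irr.
have stable (b d : letter) q : adj b.1 d.1 -> starts (linv b) (push d q) = starts (linv b) q.
  by move=> bd; rewrite starts_push neq //= bd.
have stable' (b d : letter) q : adj b.1 d.1 -> starts (linv b) (push (linv d) q) = starts (linv b) q.
  by move=> bd; rewrite starts_push neq //= bd.
(* The case in which [b] does not cancel. Used for both orders of the two letters, it leaves only
   the case in which both [a] and [c] cancel. *)
have step (b d : letter) q : adj b.1 d.1 -> valid q -> ~~ starts (linv b) q ->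
    pact b (pact d q) = pact d (pact b q).
  move=> bd vq nb; have db : adj d.1 b.1 by rewrite adj_sym.
  rewrite (pact_free nb); have [/valid_starts[]// r [vr nr] eq_q|nd] := boolP (starts (linv d) q).
    rewrite eq_q pact_push push_comm // pact_push pact_free //.
    by move: nb; rewrite eq_q stable'.
  by rewrite (pact_free nd) (@pact_free b) ?stable // (@pact_free d) ?stable // push_comm.
have [/valid_starts[]// q [vq nq] eq_p|na] := boolP (starts (linv a) p); last exact: step.
have [|nc] := boolP (starts (linv c) p); last by rewrite -step.
rewrite eq_p stable' // => /valid_starts[]// r [vr nr] eq_q.
by rewrite pact_push eq_q push_comm // !pact_push.
Qed.

Definition pil w := foldr pact pil0 w.

Lemma valid_pil w : valid (pil w).
Proof. by elim: w => [|a w IH] /=; [exact: valid0|exact: valid_act]. Qed.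

Lemma pil_cat u w : pil (u ++ w) = foldr pact (pil w) u.
Proof. exact: foldr_cat. Qed.

Definition requ : word -> word -> Prop := raag_eq (@adj g).

Lemma requ_refl w : requ w w. Proof. exact: rst_refl. Qed.
Lemma requ_sym u w : requ u w -> requ w u. Proof. exact: rst_sym. Qed.
Lemma requ_trans u w y : requ u w -> requ w y -> requ u y. Proof. exact: rst_trans. Qed.

Lemma requ_cat2 u w y y' : requ y y' -> requ (u ++ y ++ w) (u ++ y' ++ w).
Proof.
elim=> [{}y {}y' []|{}y|{}y {}y' _|{}y y1 {}y' _ IH1 _ IH2].
- move=> y1 y2 v b; apply: rst_step.
  by rewrite -!catA (catA u) (catA u y1); exact: raag_free.
- move=> y1 y2 a c ac; apply: rst_step.
  by rewrite -!catA (catA u) (catA u y1); exact: raag_comm.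
- exact: requ_refl.
- exact: requ_sym.
- exact: requ_trans IH1 IH2.
Qed.

Lemma requ_catl u w w' : requ w w' -> requ (u ++ w) (u ++ w').
Proof. by move/(requ_cat2 u [::]); rewrite !cats0. Qed.

Lemma requ_catr w u u' : requ u u' -> requ (u ++ w) (u' ++ w).
Proof. exact: (requ_cat2 [::]). Qed.

Lemma requ_cons a w w' : requ w w' -> requ (a :: w) (a :: w').
Proof. exact: (requ_catl [:: a]). Qed.

Lemma requ_free a w : requ (a :: linv a :: w) w.
Proof. by apply: rst_step; case: a => v b; exact: (@raag_free _ _ [::]). Qed.

Lemma requ_free' a w : requ (linv a :: a :: w) w.
Proof. by rewrite -{2}[a]linvK; apply: requ_free. Qed.

Lemma requ_comm a c w : adj a.1 c.1 -> requ (a :: c :: w) (c :: a :: w).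
Proof. by move=> ac; apply: rst_step; exact: (@raag_comm _ _ [::]). Qed.

Lemma pil_requ u w : requ u w -> pil u = pil w.
Proof.
elim=> [{}u {}w []|//|//|{}u y {}w _ -> _ -> //].
- move=> u1 u2 v b; rewrite !pil_cat /=; congr (foldr _ _ _).
  have := @pactK (v, b) _ (valid_pil u2); exact.
- by move=> u1 u2 a c ac; rewrite !pil_cat /= pact_comm // ; exact: valid_pil.
Qed.

Definition first a w := starts a (pil w).

Lemma first_nil a : first a [::] = false.
Proof. exact: starts0. Qed.

Lemma first_linv a w : first a w -> ~~ first (linv a) w.
Proof. by rewrite /first /starts /= => /eqP->; case: (a.2). Qed.

Lemma first_same a w : first a (a :: w) = ~~ first (linv a) w.
Proof.
rewrite /first /=; have [/(valid_starts (valid_pil w))[q [vq nq] ->]|nw] := boolP (starts _ (pil w)).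
  by rewrite pact_push; apply/negbTE; rewrite linvK in nq.
by rewrite pact_free // starts_push eqxx.
Qed.

Lemma first_adj a c w : adj a.1 c.1 -> first a (c :: w) = first a w.
Proof.
move=> ac; rewrite /first /=.
have nac b : b.1 = c.1 -> (a == b) = false.
  by move=> bc; apply: contraTF ac => /eqP ->; rewrite bc adj_irr.
have [/(valid_starts (valid_pil w))[q [vq nq] ->]|nw] := boolP (starts (linv c) (pil w)).
  by rewrite pact_push starts_push nac //= ac.
by rewrite pact_free // starts_push nac //= ac.
Qed.

Lemma first_nadj a c w : a.1 != c.1 -> ~~ adj a.1 c.1 ->
  first a (c :: w) -> first (linv c) w.
Proof.
move=> ac nac; rewrite /first /=; apply: contraLR => nw.
by rewrite pact_free // starts_push (negbTE nac) orbF; apply: contraNneq ac => ->.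
Qed.

Lemma letter_cases a c : [\/ c = a, c = linv a, adj a.1 c.1 | a.1 != c.1 /\ ~~ adj a.1 c.1].
Proof.
have [ac|nac] := boolP (adj a.1 c.1); first by constructor 3.
have [e|ne] := eqVneq a.1 c.1; last by constructor 4.
case: a c e {nac} => v x [w z] /= <-.
by have [->|nxz] := eqVneq z x; [constructor 1|constructor 2; case: x z nxz => [] []].
Qed.

Lemma first_linv_cons a w : first a (linv a :: w) -> first a w.
Proof.
move=> h; have := first_linv h; rewrite first_same linvK negbK.
by [].
Qed.

(** This identifies [first]. The induction on length inspects the first letter of [w]: it is [a], or
    it cancels, or [a] can be moved past it. The subset clause later controls the first letters of
    elements of a link subgroup. *)
Lemma first_split a w : first a w ->
  exists2 w', requ w (a :: w') & size w' < size w /\ {subset a :: w' <= w}.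
Proof.
elim: {w}_.+1 {-2}w (ltnSn (size w)) a => // n IH [|c w] /= ltn a; first by rewrite first_nil.
have red a' w' : requ w (linv c :: w') -> size w' < size w -> {subset w' <= w} ->
    first a' (c :: w) ->
    exists2 w', requ (c :: w) (a' :: w') & size w' < size (c :: w) /\ {subset a' :: w' <= c :: w}.
  move=> e sw' sub fa; have e' : requ (c :: w) w'.
    by apply: requ_trans (requ_cons c e) _; apply: requ_free.
  have fa' : first a' w' by rewrite /first -(pil_requ e').
  have [w2 e2 [s2 sub2]] := IH w' (leq_trans sw' (ltnW ltn)) a' fa'.
  exists w2; first exact: requ_trans e' e2.
  split; first by rewrite /= ltnS (leq_trans (ltnW s2)) // ltnW.
  by move=> x /sub2 /sub xw; rewrite inE xw orbT.
case: (letter_cases a c) => [->|->|ac|[ac nac]] fa.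
- by exists w; [exact: requ_refl|split].
- have /(IH w ltn)[w' e [s sub]] := first_linv_cons fa.
  have e' : requ (linv a :: w) w'.
    by apply: requ_trans (requ_cons _ e) _; apply: requ_free'.
  have fa' : first a w' by rewrite /first -(pil_requ e').
  have [w2 e2 [s2 sub2]] := IH w' (leq_trans s (ltnW ltn)) a fa'.
  exists w2; first exact: requ_trans e' e2.
  split; first by rewrite /= ltnS (leq_trans (ltnW s2)) // ltnW.
  by move=> x /sub2 xw; rewrite inE sub ?orbT // inE xw orbT.
- move: fa; rewrite first_adj // => /(IH w ltn)[w' e [s sub]].
  exists (c :: w').
    by apply: requ_trans (requ_cons c e) _; apply: requ_comm; rewrite adj_sym.
  split => //= x; rewrite !inE => /or3P[/eqP->|->//|xw].
    by rewrite sub ?orbT // mem_head.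
  by rewrite sub ?orbT // inE xw orbT.
- have [w' e [s sub]] := IH w ltn _ (first_nadj ac nac fa).
  by apply: (red a w') => // x xw; apply: sub; rewrite inE xw orbT.
Qed.

(** If the initial letter of a word is not [first], it cancels in the rest, so the word can be
    shortened. *)
Lemma first_free w : (forall a, ~~ first a w) -> requ w [::].
Proof.
elim: {w}_.+1 {-2}w (ltnSn (size w)) => // n IH [|c w] ltn nf; first exact: requ_refl.
have := nf c; rewrite first_same negbK => /first_split[w' e [s _]].
have e' : requ (c :: w) w' by apply: requ_trans (requ_cons c e) _; apply: requ_free.
apply: (requ_trans e'); apply: IH; first by rewrite (leq_trans s) // -ltnS (leq_trans _ ltn).
by move=> a; rewrite /first -(pil_requ e'); apply: nf.
Qed.

Lemma word_invE a w : word_inv (a :: w) = word_inv w ++ [:: linv a].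
Proof. by rewrite /word_inv /= rev_cons -cats1. Qed.

Lemma word_invVw w : requ (word_inv w ++ w) [::].
Proof.
elim: w => [|a w IH]; first by apply: requ_refl.
rewrite word_invE -catA; apply: requ_trans IH; apply: requ_catl.
exact: requ_free'.
Qed.

Lemma word_invwV w : requ (w ++ word_inv w) [::].
Proof.
elim: w => [|a w IH]; first by apply: requ_refl.
rewrite word_invE /= catA; apply: requ_trans (requ_free a [::]).
by apply: requ_cons; apply: (@requ_catr [:: linv a] (w ++ word_inv w) [::]).
Qed.

(** Solution of the word problem: if the pilings agree, [word_inv u ++ w] has the piling of the
    empty word, hence no first letter. *)
Lemma requP u w : requ u w <-> pil u = pil w.
Proof.
split=> [|e]; first exact: pil_requ.
have inv1 : requ (word_inv u ++ w) [::].
  apply: first_free => a; rewrite /first pil_cat -e -pil_cat.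
  by rewrite (pil_requ (word_invVw u)) starts0.
have := requ_catl u inv1; rewrite cats0 => /requ_sym e1; apply: requ_trans e1 _.
by rewrite catA; apply: (requ_catr w (word_invwV u)).
Qed.

End Pilings.

(** * The right-angled Artin group as a quotient type *)

Section Group.
Local Open Scope quotient_scope.
Variable g : sgraph.
Local Notation letter := (letter g).
Local Notation word := (word g).

(** A boolean form of the defining congruence, by [requP], so that the group is a generic quotient
    with chosen representatives. *)
Definition wequ : rel word := fun u w => pil u == pil w.

Lemma wequ_equiv : equiv_class_of wequ.
Proof.
split=> [x|x y|y x z]; rewrite /wequ ?eqxx 1?[pil x == _]eq_sym //.
by move=> /eqP-> ->.
Qed.

Canonical wequ_equivrel := EquivRelPack wequ_equiv.

Definition raag := {eq_quot wequ_equivrel}.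
HB.instance Definition _ := Choice.copy raag {eq_quot wequ_equivrel}.

Definition cls (w : word) : raag := \pi w.

Lemma clsP u w : cls u = cls w <-> requ u w.
Proof.
split=> [/eqmodP/eqP e|/requP e]; first exact/requP.
by apply/eqmodP; rewrite /= /wequ e.
Qed.

Lemma cls_repr (x : raag) : cls (repr x) = x.
Proof. exact: reprK. Qed.

Lemma repr_cls w : requ (repr (cls w)) w.
Proof. by apply/clsP; rewrite cls_repr. Qed.

Definition rmul (x y : raag) : raag := cls (repr x ++ repr y).
Definition rinv (x : raag) : raag := cls (word_inv (repr x)).

Lemma cls_cat u w : cls (u ++ w) = rmul (cls u) (cls w).
Proof.
apply/clsP; apply: requ_trans (requ_catl u (requ_sym (repr_cls w))) _.
exact: requ_catr (requ_sym (repr_cls u)).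
Qed.

Lemma rmulA : associative rmul.
Proof. by move=> x y z; rewrite -[x]cls_repr -[y]cls_repr -[z]cls_repr -!cls_cat catA. Qed.
Lemma rmul1g : left_id (cls [::]) rmul.
Proof. by move=> x; rewrite -[x]cls_repr -cls_cat. Qed.
Lemma rmulg1 : right_id (cls [::]) rmul.
Proof. by move=> x; rewrite -[x]cls_repr -cls_cat cats0. Qed.
Lemma rmulVg : left_inverse (cls [::]) rinv rmul.
Proof. by move=> x; rewrite -{2}[x]cls_repr -cls_cat; apply/clsP/word_invVw. Qed.
Lemma rmulgV : right_inverse (cls [::]) rinv rmul.
Proof. by move=> x; rewrite -{1}[x]cls_repr -cls_cat; apply/clsP/word_invwV. Qed.

HB.instance Definition _ := isGroup.Build raag rmulA rmul1g rmulg1 rmulVg rmulgV.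

End Group.

Local Open Scope group_scope.

(** * First letters *)

Section FirstLetters.
Variable g : sgraph.
Local Notation letter := (letter g).
Local Notation word := (word g).
Local Notation G := (raag g).
Implicit Types (a b c d u : letter) (w : word) (x y z f : G).

Definition lt a : G := cls [:: a].

Lemma cls_nil : cls [::] = 1 :> G. Proof. by []. Qed.

Lemma clsM w w' : cls (w ++ w') = cls w * cls w'. Proof. exact: cls_cat. Qed.

Lemma cls_cons a w : cls (a :: w) = lt a * cls w. Proof. exact: (clsM [:: a]). Qed.

Lemma lt_linv a : lt (linv a) = (lt a)^-1.
Proof.
apply: (@mulgI _ (lt a)); rewrite mulgV -[lt a * _](clsM [:: a] [:: linv a]).
by apply/clsP; apply: requ_free.
Qed.

Lemma cls_inv w : cls (word_inv w) = (cls w)^-1.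
Proof. by apply: (@mulIg _ (cls w)); rewrite mulVg -clsM; apply/clsP/word_invVw. Qed.

Lemma lt_comm a c : adj a.1 c.1 -> commute (lt a) (lt c).
Proof.
move=> ac; rewrite /commute -!(clsM [:: _] [:: _]).
by apply/clsP; apply: requ_comm.
Qed.

Definition fst_in a x := first a (repr x).

Lemma fst_cls a w : fst_in a (cls w) = first a w.
Proof. by rewrite /fst_in /first (pil_requ (repr_cls w)). Qed.

Lemma fst1 a : fst_in a 1 = false.
Proof. by rewrite -cls_nil fst_cls first_nil. Qed.

Lemma fst_linv a x : fst_in a x -> ~~ fst_in (linv a) x.
Proof. exact: first_linv. Qed.

Lemma fst_same a x : fst_in a (lt a * x) = ~~ fst_in (linv a) x.
Proof. by rewrite -(cls_repr x) -cls_cons !fst_cls first_same. Qed.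

Lemma fst_sameV a x : fst_in a ((lt a)^-1 * x) -> fst_in a x.
Proof. by rewrite -lt_linv -(cls_repr x) -cls_cons !fst_cls; apply: first_linv_cons. Qed.

Lemma fst_adj a c x : adj a.1 c.1 -> fst_in a (lt c * x) = fst_in a x.
Proof. by move=> ac; rewrite -(cls_repr x) -cls_cons !fst_cls first_adj. Qed.

Lemma fst_nadj a c x : a.1 != c.1 -> ~~ adj a.1 c.1 ->
  fst_in a (lt c * x) -> fst_in (linv c) x.
Proof.
by move=> ac nac; rewrite -(cls_repr x) -cls_cons !fst_cls; apply: first_nadj.
Qed.

Lemma len_ex x : exists n, [exists t : n.-tuple letter, cls t == x].
Proof.
exists (size (repr x)); apply/existsP; exists (in_tuple (repr x)).
by rewrite /= cls_repr.
Qed.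

Definition len x := ex_minn (len_ex x).

Lemma len_le w : len (cls w) <= size w.
Proof.
rewrite /len; case: ex_minnP => m _; apply.
by apply/existsP; exists (in_tuple w).
Qed.

Lemma len_word x : exists2 w, cls w = x & size w = len x.
Proof.
rewrite /len; case: ex_minnP => m /existsP[t /eqP tx] _.
by exists (val t); rewrite ?size_tuple.
Qed.

Lemma fst_split a x : fst_in a x ->
  exists2 y, x = lt a * y & len y < len x.
Proof.
have [w <- sw] := len_word x.
rewrite fst_cls => /first_split[w' e [s _]]; exists (cls w').
  by rewrite -cls_cons; apply/clsP.
by rewrite -sw (leq_ltn_trans (len_le w')).
Qed.

Lemma len_fst c x : len x < len (lt c * x) -> ~~ fst_in (linv c) x.
Proof.
apply: contraL => /fst_split[y ->]; rewrite lt_linv mulVKg -leqNgt; exact: ltnW.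
Qed.

(** Induction along a geodesic word: the letter [c] increases the length, and the hypothesis is
    available for every shorter element, not only for [x]. *)
Lemma len_ind (P : G -> Prop) : P 1 ->
  (forall c x, len x < len (lt c * x) ->
    (forall y, len y < len (lt c * x) -> P y) -> P (lt c * x)) ->
  forall x, P x.
Proof.
move=> P1 PS x; elim: {x}_.+1 {-2}x (ltnSn (len x)) => // n IH x.
have [[|c w] <- sw] := len_word x; first by [].
rewrite ltnS => len_n; rewrite cls_cons; apply: PS.
  by rewrite -cls_cons -sw ltnS len_le.
by move=> y ly; apply: IH; apply: leq_trans ly _; rewrite -cls_cons.
Qed.

(** Membership in the subgroup generated by the link of the vertex of [d]. *)
Definition lk d x := exists2 w, cls w = x & all (fun c => adj d.1 c.1) w.

Lemma lk1 d : lk d 1. Proof. by exists [::]. Qed.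

Lemma lk_cons d c x : adj d.1 c.1 -> lk d x -> lk d (lt c * x).
Proof. by move=> dc [w <- aw]; exists (c :: w); rewrite ?cls_cons //= dc. Qed.

Lemma lk_fst d c x : lk d x -> fst_in c x -> adj d.1 c.1.
Proof.
case=> w <- /allP aw; rewrite fst_cls => /first_split[w' _ [_ sub]].
exact/aw/sub/mem_head.
Qed.

Lemma lk_commute d x : lk d x -> commute (lt d) x.
Proof.
case=> w <-; elim: w => [|c w IH] /=; first by move=> _; apply: commute1.
case/andP=> dc /IH cw; rewrite cls_cons; apply: commuteM => //; exact: lt_comm.
Qed.

Lemma lk_fix d x y : lk d x -> fst_in d (x * y) = fst_in d y.
Proof.
case=> w <-; elim: w => [|c w IH] /=; first by rewrite cls_nil mul1g.
by case/andP=> dc aw; rewrite cls_cons -mulgA fst_adj ?IH.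
Qed.

Lemma fst_lt a b : fst_in a (lt b) = (a == b).
Proof.
rewrite -[lt b]mulg1; case: (letter_cases a b) => [->|->|ab|[ab nab]].
- by rewrite fst_same fst1 eqxx.
- rewrite eq_sym linv_neq; apply/negP => h.
  by move: h; rewrite lt_linv => /fst_sameV; rewrite fst1.
- rewrite fst_adj // fst1; apply/esym/negbTE; apply: contraTneq ab => ->.
  by rewrite adj_irr.
- rewrite (_ : (a == b) = false); last by apply: contraNF ab => /eqP->.
  by apply/negP => /(fst_nadj ab nab); rewrite fst1.
Qed.

(* Crossing an edge labelled [b] can change whether a word starts with [d]
   only if that edge is dual to the wall of [d]. *)
Lemma fst_edge x d b : ~~ fst_in d x -> fst_in d (x * lt b) -> b = d /\ lk d x.
Proof.
elim/len_ind: x d b => [|c x lx IH] d b.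
  by rewrite mul1g fst_lt => _ /eqP->; split=> //; apply: lk1.
have nc := len_fst lx; rewrite -mulgA.
case: (letter_cases d c) => [e|e|dc|[dc ndc]].
- by move: nc; rewrite e fst_same negbK => /negP.
- move: nc; rewrite e linvK lt_linv => nc nd fd.
  have [eb lkx] := IH x lx d b nc (fst_sameV fd).
  by move: fd; rewrite eb -(lk_commute lkx) mulKg (negbTE nc).
- rewrite !fst_adj // => nd fd; have [-> lkx] := IH x lx d b nd fd.
  by split=> //; apply: lk_cons.
(* Here [c] cancels only after the edge is crossed, so by induction [b] is [linv c] and [x] lies in
   the link subgroup of [c]. The product is then [x] itself, whose first letters are all adjacent to
   [c]. *)
- move=> _ fd; have fc := fst_nadj dc ndc fd.
  have [eb lkx] := IH x lx (linv c) b nc fc.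
  move: fd; rewrite eb -(lk_commute lkx) lt_linv mulVKg => /(lk_fst lkx).
  by rewrite adj_sym (negbTE ndc).
Qed.
End FirstLetters.

(** * Walls and halfspaces *)

Section Walls.
Variable g : sgraph.
Local Notation letter := (letter g).
Local Notation word := (word g).
Local Notation G := (raag g).

(* [(p, a)] stands for the halfspace of the elements separated from [p] by the
   wall dual to the edge from [p] to [p * a]. *)
Definition hs := (G * letter)%type.
Implicit Types (a b c d u : letter) (w : word) (x y z f p q : G) (h k m : hs).

Definition inh h x := fst_in h.2 (h.1^-1 * x).
Definition tr f h : hs := (f * h.1, h.2).
Definition hc h : hs := (h.1 * lt h.2, linv h.2).
Definition cl h : G := h.1 * lt h.2 * h.1^-1.
Definition hle h k := forall x, inh h x -> inh k x.
(** Different edges can be dual to the same wall, so halfspaces are compared as sets. *)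
Definition heq h k := forall x, inh h x = inh k x.
(** One of the four intersections of halfspaces bounded by the two walls is empty. *)
Definition nested h k := [\/ hle h k, hle k h, hle h (hc k) | hle (hc k) h].
Definition cross h k := adj h.2.1 k.2.1 && (cl h * cl k == cl k * cl h).

Lemma inh_tr f h x : inh (tr f h) x = inh h (f^-1 * x).
Proof. by rewrite /inh /= invgM mulgA. Qed.

Lemma inh_hc h x : inh (hc h) x = ~~ inh h x.
Proof.
rewrite /inh /= invgM -mulgA -lt_linv fst_same linvK //.
Qed.

Lemma hcK h : hc (hc h) = h.
Proof. by case: h => p a; rewrite /hc /= linvK lt_linv mulgK. Qed.

Lemma hc_tr f h : hc (tr f h) = tr f (hc h).
Proof. by rewrite /hc /tr /= mulgA. Qed.

Lemma trM f f' h : tr (f * f') h = tr f (tr f' h).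
Proof. by rewrite /tr /= mulgA. Qed.
Lemma tr1 h : tr 1 h = h.
Proof. by case: h => p a; rewrite /tr mul1g. Qed.
Lemma trK f h : tr f^-1 (tr f h) = h.
Proof. by rewrite -trM mulVg tr1. Qed.
Lemma trKV f h : tr f (tr f^-1 h) = h.
Proof. by rewrite -trM mulgV tr1. Qed.

Lemma cl_tr f h : cl (tr f h) = f * cl h * f^-1.
Proof. by rewrite /cl /= invgM !mulgA. Qed.
Lemma cl_hc h : cl (hc h) = (cl h)^-1.
Proof. by rewrite /cl /= !invgM invgK lt_linv mulgK mulgA. Qed.

Lemma inh_base h : ~~ inh h h.1.
Proof. by rewrite /inh mulVg fst1. Qed.
Lemma inh_end h : inh h (h.1 * lt h.2).
Proof. by rewrite /inh mulKg fst_lt. Qed.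

Lemma hle_trans k h m : hle h k -> hle k m -> hle h m.
Proof. by move=> hk km x /hk /km. Qed.
Lemma hle_tr f h k : hle (tr f h) (tr f k) <-> hle h k.
Proof.
split=> [le x|le x]; last by rewrite !inh_tr; apply: le.
by have := le (f * x); rewrite !inh_tr mulKg.
Qed.
Lemma hle_hc h k : hle (hc h) (hc k) <-> hle k h.
Proof.
by split=> le x; have := le x; rewrite !inh_hc; [apply: contraTT|apply: contra].
Qed.
Lemma hle_hcr h k : hle h (hc k) <-> hle k (hc h).
Proof. by rewrite -hle_hc hcK. Qed.
Lemma hle_hcl h k : hle (hc h) k <-> hle (hc k) h.
Proof. by rewrite -hle_hc hcK. Qed.

Lemma heq_refl h : heq h h. Proof. by []. Qed.
Lemma heq_sym h k : heq h k -> heq k h. Proof. by move=> e x; rewrite e. Qed.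
Lemma heq_trans k h m : heq h k -> heq k m -> heq h m.
Proof. by move=> e e' x; rewrite e. Qed.
Lemma hle_anti h k : hle h k -> hle k h -> heq h k.
Proof. by move=> le ge x; apply/idP/idP; auto. Qed.
Lemma heq_tr f h k : heq h k -> heq (tr f h) (tr f k).
Proof. by move=> e x; rewrite !inh_tr e. Qed.
Lemma heq_hc h k : heq h k -> heq (hc h) (hc k).
Proof. by move=> e x; rewrite !inh_hc e. Qed.

Lemma heq_lk p c d : adj c.1 d.1 -> heq (p * lt c, d) (p, d).
Proof.
move=> cd x; rewrite /inh /= invgM -mulgA -lt_linv fst_adj //=.
by rewrite adj_sym.
Qed.

Lemma wall_edge h x c : ~~ inh h x -> inh h (x * lt c) ->
  c = h.2 /\ heq h (x, c).
Proof.
rewrite /inh mulgA => nx xc; have [-> lkx] := fst_edge nx xc; split=> // y.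
by rewrite /inh /= -(lk_fix (x^-1 * y) lkx) -mulgA mulVKg.
Qed.

Lemma heq_label h k : heq h k -> h.2 = k.2.
Proof.
move=> e; have [||-> //] := @wall_edge h k.1 k.2; first by rewrite e inh_base.
by rewrite e inh_end.
Qed.

(** Seen from the base of [k], the element becomes [z], which preserves the halfspace of [u]. The
    edge from [z] to [z * lt u] enters that halfspace, so [fst_edge] puts [z] into the link subgroup
    of [u]. *)
Lemma fix_commute f k : heq (tr f k) k -> commute f (cl k).
Proof.
case: k => q u e; pose z := q^-1 * f * q.
have ef : f = q * z * q^-1 by rewrite /z !mulgA mulgV mul1g mulgK.
have zE x : fst_in u (z * x) = fst_in u x.
  have := e (f * (q * x)); rewrite inh_tr mulKg /inh /= mulKg => ->.
  by rewrite /z -!mulgA.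
have [||_ lkz] := @fst_edge g z u u.
- by rewrite -[z]mulg1 zE fst1.
- by rewrite zE fst_lt.
move: z ef lkz {e zE} => z -> lkz.
rewrite /commute /cl /= -!mulgA !mulKg; congr (q * _); rewrite !mulgA.
by rewrite (lk_commute lkz).
Qed.

Lemma nested_tr f h k : nested (tr f h) (tr f k) <-> nested h k.
Proof.
rewrite /nested hc_tr; split=> -[] le; [constructor 1|constructor 2|constructor 3|
  constructor 4|constructor 1|constructor 2|constructor 3|constructor 4];
  by [apply/(hle_tr f)|apply/hle_tr].
Qed.

Lemma nested_heq h h' k k' : heq h h' -> heq k k' -> nested h k -> nested h' k'.
Proof.
move=> eh ek; have eh' := heq_hc eh; have ek' := heq_hc ek.
by case=> le; [constructor 1|constructor 2|constructor 3|constructor 4] => x;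
  rewrite -?eh -?ek -?ek' -?eh'; apply: le.
Qed.

Lemma nested_sym h k : nested h k -> nested k h.
Proof.
case=> le; [by constructor 2|by constructor 1|constructor 3|constructor 4].
  by rewrite hle_hcr.
by rewrite hle_hcl.
Qed.

Lemma nested_hcr h k : nested h (hc k) <-> nested h k.
Proof.
suff nhc k' : nested h k' -> nested h (hc k').
  by split=> [/nhc|/nhc //]; rewrite hcK.
case=> le; [constructor 3|constructor 4|constructor 1|constructor 2] => //;
  by rewrite hcK.
Qed.

(** The induction removes the first letter [b] of a geodesic leading to the first wall and
    translates both walls back. The wall of [a] is again at the base point if [b] is [a] or is
    adjacent to it; otherwise its halfspace moves inside that of [linv b]. *)
Lemma wall_cases_aux q u a : nested (q, u) (1, a) \/
  (adj u.1 a.1 /\ heq (tr (lt a) (q, u)) (q, u)).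
Proof.
elim/len_ind: q u a => [|b q lq IH] u a.
  case: (letter_cases a u) => [->|->|au|[au nau]].
  - by left; constructor 1.
  - left; constructor 3 => x; rewrite inh_hc /inh /= !invg1 !mul1g.
    by move=> /fst_linv; rewrite linvK.
  - right; split; first by rewrite adj_sym.
    by rewrite /tr /= mulg1 -[lt a]mul1g; apply: heq_lk.
  - left; constructor 3 => x; rewrite inh_hc /inh /= !invg1 !mul1g.
    move=> fu; have [y e _] := fst_split fu; apply/negP; rewrite e.
    by move/(fst_nadj au nau); apply/negP; rewrite -fst_same -e.
have nq := len_fst lq; pose k : hs := (q, u).
have e1 f : tr f (1, a) = (f, a) by rewrite /tr /= mulg1.
rewrite -/(tr (lt b) k) -{1}(trKV (lt b) (1, a)) nested_tr e1.
(* The wall of [d] serves as a screen: [k] is compared with it by induction, and nestedness passes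
   on to the halfspace [(lt d, a)] behind it. If [d] fixes [k] instead, the induction hypothesis for
   [a] applies to [k]. *)
have other d : d = linv b -> hle (lt d, a) (1, d) ->
    nested k ((lt b)^-1, a) \/ adj u.1 a.1 /\ heq (tr (lt a) (tr (lt b) k)) (tr (lt b) k).
  move=> ed led; have edb : lt d = (lt b)^-1 by rewrite ed lt_linv.
  rewrite -edb; case: (IH q lq u d) => [[le|le|le|le]|[ud fix_d]].
  - have [||_ e] := @wall_edge (1, d) q u.
    + by rewrite /inh /= invg1 mul1g ed.
    + by apply: le; apply: inh_end.
    by left; constructor 2 => x /led; rewrite e.
  - by left; constructor 2; apply: hle_trans led le.
  - by left; constructor 3; apply: hle_trans le _; rewrite hle_hc.
  - have := le q; rewrite inh_hc /inh /= invg1 mul1g ed nq => /(_ isT).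
    by rewrite mulVg fst1.
  - have fix_b : heq (tr (lt b) k) k.
      by apply: heq_sym; rewrite -{1}(trKV (lt b) k) -edb; apply: heq_tr.
    case: (IH q lq u a) => [n|[ua fix_a]]; last first.
      right; split=> //; apply: heq_trans (heq_tr _ fix_b) _.
      exact: heq_trans fix_a (heq_sym fix_b).
    left; suff : nested (tr (lt b) k) (1, a).
      by rewrite -(trKV (lt b) (1, a)) nested_tr e1 -edb.
    exact: nested_heq (heq_sym fix_b) (heq_refl _) n.
case: (letter_cases a b) => [eb|eb|ab|[ab nab]].
- have -> : ((lt b)^-1, a) = hc (1, linv a) by rewrite /hc /= linvK mul1g lt_linv eb.
  case: (IH q lq u (linv a)) => [n|[ua fix_a]]; first by left; apply/nested_hcr.
  right; split=> //; rewrite eb; apply: heq_tr.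
  by apply: heq_sym; rewrite -{1}(trKV (lt a) k) -lt_linv; apply: heq_tr.
- apply: (other a); first by rewrite eb linvK.
  by move=> x; rewrite /inh /= invg1 mul1g; apply: fst_sameV.
- case: (IH q lq u a) => [n|[ua fix_a]].
    left; apply: nested_heq (heq_refl _) _ n; apply: heq_sym.
    by rewrite -lt_linv -[lt _]mul1g; apply: heq_lk; rewrite adj_sym.
  by right; split=> //; rewrite -trM (lt_comm ab) trM; apply: heq_tr.
- apply: (other (linv b)) => // x; rewrite /inh /= invg1 mul1g lt_linv invgK.
  exact: fst_nadj.
Qed.

Lemma wall_cases h k : nested h k \/
  (adj h.2.1 k.2.1 /\ heq (tr (cl h) k) k).
Proof.
case: h k => p a [q u]; rewrite /cl /= !trM.
have e1 : (p, a) = tr p (1, a) by rewrite /tr /= mulg1.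
have e2 : (q, u) = tr p (p^-1 * q, u) by rewrite /tr /= mulVKg.
case: (wall_cases_aux (p^-1 * q) u a) => [n|[ua fix_a]].
  by left; apply: nested_sym; rewrite e1 e2 nested_tr.
by right; rewrite e2 trK adj_sym; split=> //; apply: heq_tr.
Qed.

Lemma cross_sym h k : cross h k = cross k h.
Proof. by rewrite /cross adj_sym eq_sym. Qed.

Lemma not_nested h k : ~ nested h k ->
  [/\ cross h k, heq (tr (cl h) k) k & heq (tr (cl k) h) h].
Proof.
move=> n; case: (wall_cases h k) => // -[hk fixk].
case: (wall_cases k h) => [/nested_sym//|[_ fixh]].
by split=> //; rewrite /cross hk; apply/eqP/fix_commute.
Qed.

Lemma nested_label h k : h.2.1 = k.2.1 -> nested h k.
Proof. by move=> e; case: (wall_cases h k) => // -[]; rewrite e adj_irr. Qed.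

End Walls.

(** * Finite choices and minimal numbers *)

Lemma pigeonhole (T : choiceType) (L : seq T) (Q : nat -> T -> Prop) :
  (forall n, exists2 m, m \in L & Q n m) ->
  exists i j m, [/\ i < j, Q i m & Q j m].
Proof.
move=> QL; have [|F QF] := @fin_all_exists 'I_(size L).+1 (fun=> seq_sub (undup L))
  (fun i m => Q i (ssval m)).
  by move=> i; have [m] := QL i; rewrite -mem_undup => mL; exists (SeqSub mL).
have /injectivePn[i [j neq_ij eqF]] : ~~ injectiveb F.
  apply/negP => /injectiveP/leq_card; rewrite card_ord card_seq_sub ?undup_uniq //.
  by rewrite ltnNge size_undup.
have [lt_ij|lt_ji|eq_ij] := ltngtP i j.
- by exists i, j, (ssval (F i)); split=> //; rewrite eqF.
- by exists j, i, (ssval (F i)); split=> //; rewrite eqF.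
- by case/eqP: neq_ij; apply: val_inj.
Qed.

Lemma least_nat (P : nat -> Prop) n : P n -> exists2 m, P m & forall k, P k -> m <= k.
Proof.
elim/ltn_ind: n => n IH Pn; case: (classic (exists2 m, P m & m < n)) => [[m Pm /IH]|no]; first exact.
by exists n => // m Pm; rewrite leqNgt; apply/negP => lt; apply: no; exists m.
Qed.

Lemma first_step (P : nat -> bool) n : ~~ P 0 -> P n ->
  exists j, ~~ P j /\ P j.+1.
Proof.
elim: n => [/negP//|n IH] P0 Pn; have [Pn'|nPn'] := boolP (P n); first exact: IH.
by exists n.
Qed.

(** * Skewered walls *)

Section Skewering.
Variable g : sgraph.
Local Notation letter := (letter g).
Local Notation word := (word g).
Local Notation G := (raag g).
Local Notation hs := (hs g).
Implicit Types (a b c d u : letter) (w : word) (x y z f p q t : G) (h k : hs).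

Definition skew f h := hle (tr f h) h /\ ~ hle h (tr f h).
Definition skewers f h := skew f h \/ skew f^-1 h.

Lemma hle_trV f h k : hle (tr f^-1 h) k <-> hle h (tr f k).
Proof.
split=> le; first by rewrite -(trKV f h); apply/hle_tr.
by rewrite -(trK f k); apply/hle_tr.
Qed.

Lemma hle_trVr f h k : hle h (tr f^-1 k) <-> hle (tr f h) k.
Proof.
split=> le; first by rewrite -(trKV f k); apply/hle_tr.
by rewrite -(trK f h); apply/hle_tr.
Qed.

Lemma skew_hc f h : skew f (hc h) <-> skew f^-1 h.
Proof.
rewrite /skew -hc_tr; split=> -[le n]; split.
- by apply/hle_trV/hle_hc.
- by move=> /hle_trVr ge; apply: n; apply/hle_hc.
- by apply/hle_hc/hle_trV.
- by move=> /hle_hc ge; apply: n; apply/hle_trVr.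
Qed.

Lemma skew_conj p f h : skew f h -> skew (p * f * p^-1) (tr p h).
Proof.
have e : tr (p * f * p^-1) (tr p h) = tr p (tr f h) by rewrite !trM trK.
by case=> le n; rewrite /skew e; split=> [|/hle_tr//]; apply/hle_tr.
Qed.

Lemma skewJ f z h : commute z f -> skew f h -> skew f (tr z h).
Proof. by move=> zf s; rewrite -(mulgK z f) -zf; apply: skew_conj. Qed.

Lemma skew_neq f h : skew f h -> ~ heq (tr f h) h.
Proof. by case=> _ n e; apply: n => x; rewrite e. Qed.

Lemma skewers_neq f h : skewers f h -> ~ heq (tr f h) h.
Proof.
case=> [/skew_neq//|/skew_neq n e]; apply: n.
by apply: heq_sym; rewrite -{1}(trK f h); apply: heq_tr.
Qed.

Lemma skew_leq f h m n : skew f h -> m <= n -> hle (tr (f ^+ n) h) (tr (f ^+ m) h).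
Proof.
move=> [le _] /subnK <-; elim: (n - m)%N => [|i IH]; first by [].
rewrite addSn expgSr trM; apply: hle_trans IH; exact/hle_tr.
Qed.

(** The list consists of the edges of a path from [x] to [y]: a halfspace containing [y] but not [x]
    is entered along one of them. *)
Lemma separators x y : exists L : seq hs,
  forall h, ~~ inh h x -> inh h y -> exists2 k, k \in L & heq h k.
Proof.
have [w <-] : exists w, x * cls w = y by exists (repr (x^-1 * y)); rewrite cls_repr mulVKg.
elim: w x => [|c w IH] x; first by exists [::] => h; rewrite cls_nil mulg1 => /negP.
have [L HL] := IH (x * lt c); exists ((x, c) :: L) => h nx.
rewrite cls_cons mulgA; have [hx _|nh /(HL _ nh)[k kL]] := boolP (inh h (x * lt c)).
  by exists (x, c); rewrite ?mem_head //; have [] := wall_edge nx hx.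
by exists k; rewrite // inE kL orbT.
Qed.

(** Otherwise all the decreasing translates [f ^+ n h] separate [h.1] from [x]. Finitely many walls
    do so, hence two translates coincide, against strictness. *)
Lemma skew_out f h x : skew f h -> exists n, ~~ inh (tr (f ^+ n) h) x.
Proof.
move=> sk; apply: NNPP => no; have [L HL] := separators h.1 x.
have [n|i [j [m [lt_ij ei ej]]]] := @pigeonhole _ L (fun n => heq (tr (f ^+ n) h)).
  apply: HL; last by apply/negPn/negP => ?; apply: no; exists n.
  by apply: contra (inh_base h) => /(skew_leq sk (leq0n n)); rewrite tr1.
have := skew_leq sk lt_ij; have e := heq_trans ei (heq_sym ej).
case: (sk) => _ no' le; apply: no'; rewrite -(hle_tr (f ^+ i)) -trM -expgSr.
by move=> z; rewrite e; apply: le.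
Qed.

Lemma skew_in f h x : skew f h -> exists n, inh (tr (f^-1 ^+ n) h) x.
Proof.
rewrite -{1}[f]invgK -skew_hc => /(skew_out x)[n].
by rewrite -hc_tr inh_hc negbK; exists n.
Qed.

Lemma skew_in_leq f h x m n : skew f h -> m <= n ->
  inh (tr (f^-1 ^+ m) h) x -> inh (tr (f^-1 ^+ n) h) x.
Proof.
rewrite -{1}[f]invgK -skew_hc => sk mn; have := skew_leq sk mn.
by rewrite -!hc_tr hle_hc; apply.
Qed.

(** The halfspaces [tr z h] and [h] carry the same label, hence are nested. They are neither
    disjoint nor jointly everything, since far along the axis of [f] there are points in both and
    points in neither. *)
Lemma commute_skew f z h : commute f z -> skew f h ->
  heq (tr z h) h \/ skewers z h.
Proof.
move=> fk sk; case: (nested_label (h := tr z h) (k := h)) => // le.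
- case: (classic (hle h (tr z h))) => ge; first by left; apply: hle_anti.
  by right; left.
- case: (classic (hle (tr z h) h)) => ge; first by left; apply: hle_anti.
  by right; right; split; rewrite -(hle_tr z) trKV.
- have [n1 h1] := skew_in 1 sk; have [n2 h2] := skew_in z^-1 sk.
  have le1 := leq_maxl n1 n2; have le2 := leq_maxr n1 n2.
  move: (skew_in_leq sk le1 h1) (skew_in_leq sk le2 h2) => {h1 h2 le1 le2}.
  move: (maxn _ _) => n; set F := f^-1 ^+ n; rewrite !inh_tr mulg1.
  have -> : F^-1 * z^-1 = z^-1 * F^-1.
    apply: commute_sym; apply/commuteV/commuteX/commuteV/commute_sym/commuteV.
    exact: fk.
  by move=> h1 h2; have := le F^-1; rewrite inh_hc inh_tr h2 h1 => /(_ isT).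
- have [n1 h1] := skew_out 1 sk; have [n2 h2] := skew_out z^-1 sk.
  have le1 := leq_maxl n1 n2; have le2 := leq_maxr n1 n2.
  have h1' := contra (skew_leq sk le1 (x := 1)) h1.
  have h2' := contra (skew_leq sk le2 (x := z^-1)) h2.
  move: {h1 h2 le1 le2} h1' h2'; move: (maxn _ _) => n; set F := f ^+ n.
  rewrite !inh_tr mulg1; have -> : F^-1 * z^-1 = z^-1 * F^-1.
    apply: commute_sym; apply/commuteV/commuteX/commute_sym/commuteV.
    exact: fk.
  by move=> h1 h2; have := le F^-1; rewrite inh_hc inh_tr h1 (negbTE h2) => /(_ isT).
Qed.

Lemma commute_skewers f z h : commute f z -> skewers f h ->
  heq (tr z h) h \/ skewers z h.
Proof.
move=> fk [|]; first exact: commute_skew.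
apply: commute_skew; exact/commute_sym/commuteV/commute_sym.
Qed.

(** Powers of [f] move any point into [k] and out of [k] without changing its side of [h], so all
    four intersections are nonempty. *)
Lemma fix_skew f h k : heq (tr f h) h -> skew f k -> ~ nested h k.
Proof.
move=> fixh sk.
have fixn n : heq (tr (f ^+ n) h) h.
  elim: n => [|n IH]; first by rewrite tr1.
  rewrite expgS trM; exact: heq_trans (heq_tr _ IH) fixh.
have zin x : exists2 z, inh h z = inh h x & inh k z.
  have [n kx] := skew_in x sk; exists (f ^+ n * x); last first.
    by move: kx; rewrite inh_tr expVgn invgK.
  by rewrite -(fixn n) inh_tr mulKg.
have zout x : exists2 z, inh h z = inh h x & ~~ inh k z.
  have [n kx] := skew_out x sk; exists ((f ^+ n)^-1 * x); last first.
    by move: kx; rewrite inh_tr.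
  by rewrite -inh_tr fixn.
case=> le.
- by have [z e /negP] := zout (h.1 * lt h.2); apply; apply: le; rewrite e inh_end.
- by have [z e /le] := zin h.1; rewrite e (negbTE (inh_base h)).
- have [z e kz] := zin (h.1 * lt h.2); have := le z.
  by rewrite inh_hc e inh_end kz => /(_ isT).
- have [z e kz] := zout h.1; have := le z.
  by rewrite inh_hc e kz (negbTE (inh_base h)) => /(_ isT).
Qed.

Lemma fix_skewers f h k : heq (tr f h) h -> skewers f k -> ~ nested h k.
Proof.
move=> fixh [|]; apply: fix_skew => //.
by apply: heq_sym; rewrite -{1}(trK f h); apply: heq_tr.
Qed.

Lemma skew_cl h : skew (cl h) h.
Proof.
case: h => p a; have e : tr (cl (p, a)) (p, a) = (p * lt a, a).
  by rewrite /tr /cl /= mulgVK.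
split; rewrite e.
  by move=> x; rewrite /inh /= invgM -mulgA; apply: fst_sameV.
by move/(_ _ (inh_end (p, a))); apply/negP; apply: (inh_base (p * lt a, a)).
Qed.

Lemma heq_cl h k : heq h k -> cl h = cl k.
Proof.
case: h k => p a [q b] e; have eab : a = b := heq_label e; rewrite -eab in e *.
have [||_ lkz] := @fst_edge g (p^-1 * q) a a.
- by have := inh_base (q, a); rewrite -e.
- by rewrite -mulgA; have := inh_end (q, a); rewrite -e.
have -> : q = p * (p^-1 * q) by rewrite mulVKg.
move: (p^-1 * q) lkz => z lkz; rewrite /cl /= invgM mulgA -(mulgA p z).
by rewrite -(lk_commute lkz) mulgA mulgK.
Qed.

(** The vertices [x j * q] form an axis of [cl k], all of whose edges carry the label of [k] and the
    conjugated letter [cl k]. The halfspace [h] is entered along one of these edges. *)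
Lemma skew_cl_parallel h k : skew (cl k) h -> h.2 = k.2 /\ cl h = cl k.
Proof.
case: k => q a; set f := cl _ => sk.
have [n1 out] := skew_out q sk; have [n2 ins] := skew_in q sk.
pose x j := f ^+ j * f ^- n1.
have fx j : commute f (x j) by apply: commuteM; [exact: commuteX|exact/commuteV/commuteX].
have faE z : commute f z -> z * q * lt a = f * (z * q).
  by move=> fz; rewrite [RHS]mulgA fz /f /cl /= !mulgA mulgVK.
have xS j : x j.+1 * q = x j * q * lt a by rewrite (faE _ (fx j)) /x expgS !mulgA.
have [j [nj ij]] : exists j, ~~ inh h (x j * q) /\ inh h (x j.+1 * q).
  apply: (@first_step (fun j => inh h (x j * q)) (n2 + n1)).
    by move: out; rewrite inh_tr /x mul1g.
  by move: ins; rewrite inh_tr expVgn invgK /x expgnDr mulgK.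
move: ij; rewrite xS => ij; have [ea e] := wall_edge nj ij.
by split; [exact: esym|rewrite (heq_cl e) /cl /= (faE _ (fx j)) mulgK].
Qed.

Lemma skewers_cl_parallel h k : skewers (cl k) h ->
  h.2.1 = k.2.1 /\ (cl h = cl k \/ cl h = (cl k)^-1).
Proof.
case=> [/skew_cl_parallel[-> ->]|]; first by split; [|left].
by rewrite -skew_hc => /skew_cl_parallel[<- <-]; rewrite cl_hc invgK; split; [|right].
Qed.

(** The commuting element [cl k] fixes or skewers [h]. Skewering forces equal vertices, which
    adjacency excludes, and a fixed wall is not nested with a skewered one. *)
Lemma cross_nested h k : cross h k -> ~ nested h k.
Proof.
case/andP=> adj_hk /eqP ck.
case: (commute_skew (z := cl k) ck (skew_cl h)) => [fixh|].
  exact: fix_skew fixh (skew_cl k).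
by case/skewers_cl_parallel=> e; rewrite e adj_irr in adj_hk.
Qed.

Lemma cross_fix h k : cross h k -> heq (tr (cl h) k) k.
Proof. by move/cross_nested/not_nested=> []. Qed.

Lemma fix_cross f h k : heq (tr f h) h -> skewers f k -> cross h k.
Proof. by move=> fixh sk; have [] := not_nested (fix_skewers fixh sk). Qed.

Lemma skewers_share f f' h k : commute f f' -> skewers f h -> skewers f' k ->
  ~~ cross h k -> skewers f' h /\ skewers f k.
Proof.
move=> ff' sh sk nc; split.
  case: (commute_skewers ff' sh) => // fixh.
  by rewrite (fix_cross fixh sk) in nc.
case: (commute_skewers (commute_sym ff') sk) => // fixk.
by rewrite cross_sym (fix_cross fixk sh) in nc.
Qed.

Lemma commute_cl h k : commute (cl h) (cl k) ->
  cross h k \/ h.2.1 = k.2.1 /\ (cl h = cl k \/ cl h = (cl k)^-1).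
Proof.
move=> ck; case: (commute_skew ck (skew_cl h)) => [fixh|].
  by left; have [] := not_nested (fix_skew fixh (skew_cl k)).
by move/skewers_cl_parallel; right.
Qed.

(** No base edge is dual to the wall of [m], for its conjugated letter would commute with [cl m]. If
    the base edges lay on different sides, a halfspace of [h] and one of [k] would be separated by
    [m], so that [h] and [k] would be nested. *)
Lemma cross_side h k (m : hs) : cross h k ->
  ~ commute (cl h) (cl m) -> ~ commute (cl k) (cl m) -> inh m h.1 = inh m k.1.
Proof.
move=> hk nh nk.
suff no h' k' : cross h' k' -> ~ commute (cl h') (cl m) -> ~ commute (cl k') (cl m) ->
    ~~ inh m h'.1 -> inh m k'.1 -> False.
  apply/idP/idP => i; apply/negPn/negP => ni; last exact: (no h k).
  by apply: (no k h) => //; rewrite cross_sym.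
move: h' k' => {hk nh nk} {}h {}k hk nh nk hm km.
have nest (x : hs) : ~ commute (cl x) (cl m) -> nested x m.
  move=> nx; case: (classic (nested x m)) => // /not_nested[/andP[_ /eqP]].
  by [].
have hend : ~~ inh m (h.1 * lt h.2).
  apply/negP => i; have [_ /heq_cl e] := wall_edge hm i.
  by apply: nh; rewrite e -surjective_pairing.
have kend : inh m (k.1 * lt k.2).
  apply/negPn/negP; rewrite -inh_hc => i.
  have [||_ /heq_cl e] := @wall_edge g (hc m) k.1 k.2 => //; first by rewrite inh_hc km.
  by apply: nk; rewrite /commute -[cl m]invgK -cl_hc e -surjective_pairing mulgV mulVg.
apply: (cross_nested hk).
case: (nest h nh) => hle_hm.
- by have := hle_hm _ (inh_end h); rewrite (negbTE hend).
- case: (nest k nk) => hle_km.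
  + by constructor 2; apply: hle_trans hle_km hle_hm.
  + by have := hle_km _ km; rewrite (negbTE (inh_base k)).
  + by have := hle_km _ (inh_end k); rewrite inh_hc kend.
  + by constructor 4; apply: hle_trans hle_hm; apply/hle_hcl.
- case: (nest k nk) => hle_km.
  + by constructor 3; apply: hle_trans hle_hm _; apply/hle_hc.
  + by have := hle_km _ km; rewrite (negbTE (inh_base k)).
  + by have := hle_km _ (inh_end k); rewrite inh_hc kend.
  + by constructor 1; apply: hle_trans hle_hm hle_km.
- by have := hle_hm h.1; rewrite inh_hc hm (negbTE (inh_base h)) => /(_ isT).
Qed.

Definition gprod (s : seq hs) : G := foldr (fun h x => cl h * x) 1 s.

Lemma gprod_cat s s' : gprod (s ++ s') = gprod s * gprod s'.
Proof. by elim: s => [|h s IH] /=; rewrite ?mul1g // IH mulgA. Qed.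

(** The edges are listed last first, because in this order the product of their conjugated letters
    telescopes to [p * cls w * p^-1]. *)
Fixpoint edges p w : seq hs :=
  if w is a :: w' then rcons (edges (p * lt a) w') (p, a) else [::].

Lemma gprod_edges p w : gprod (edges p w) = p * cls w * p^-1.
Proof.
elim: w p => [|a w IH] p; first by rewrite cls_nil mulg1 mulgV.
rewrite /= -cats1 gprod_cat IH /= mulg1 cls_cons /cl /= invgM.
by rewrite !mulgA !mulgVK.
Qed.

Lemma mem_edges p w h : h \in edges p w ->
  exists w1 w2, w = w1 ++ h.2 :: w2 /\ h.1 = p * cls w1.
Proof.
elim: w p => [|a w IH] p //=; rewrite mem_rcons inE => /orP[/eqP->|].
  by exists [::], w; rewrite cls_nil mulg1.
case/IH => w1 [w2 [-> ->]]; exists (a :: w1), w2.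
by rewrite cls_cons mulgA.
Qed.

Lemma shortest_conj f : exists p w, f = p * cls w * p^-1 /\
  forall p' w', f = p' * cls w' * p'^-1 -> size w <= size w'.
Proof.
pose P n := exists p w, f = p * cls w * p^-1 /\ size w = n.
have Pn : P (size (repr f)) by exists 1, (repr f); rewrite cls_repr mul1g invg1 mulg1.
have [n [p [w [e sw]]] min] := least_nat Pn.
by exists p, w; split=> // p' w' e'; rewrite sw; apply: min; exists p', w'.
Qed.

(** The halfspaces [tr y h] and [h] carry the same label, hence are nested; the points [1], [y] and
    [y * lt a] decide how. In the last case [y] would be the conjugate by [a] of a shorter word,
    against minimality. *)
Lemma shortest_skew p a w :
  (forall p' w', p * cls (a :: w) * p^-1 = p' * cls w' * p'^-1 -> size w < size w') ->
  skew (p * cls (a :: w) * p^-1) (p, a).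
Proof.
move=> min; have -> : (p, a) = tr p (1, a) by rewrite /tr /= mulg1.
apply: skew_conj; set y := cls _; pose h : hs := (1, a).
have iny x : inh h x = fst_in a x by rewrite /inh invg1 mul1g.
have short w' : y = cls w' -> size w < size w' by move=> e; apply: (min p); rewrite -/y e.
have hy : inh h y.
  rewrite iny /y cls_cons fst_same fst_cls; apply/negP => /first_split[w' e [s _]].
  have: size w < size w'; last by rewrite ltnNge ltnW.
  by apply: short; apply/clsP; apply: requ_trans (requ_cons a e) (requ_free _ _).
have h1 : ~~ inh h 1 := inh_base h.
have yy : ~~ inh (tr y h) y by rewrite inh_tr mulVg.
have hya : inh h (y * lt a).
  apply/negPn/negP; rewrite -inh_hc => i.
  have [||e _] := @wall_edge g (hc h) y a; [by rewrite inh_hc hy|exact: i|].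
  by have := linv_neq a; rewrite -[linv a]/((hc h).2) -e eqxx.
case: (@nested_label g (tr y h) h) => // le.
- by split=> // /(_ y hy); apply/negP.
- by have := le y hy; rewrite (negbTE yy).
- have := le (y * lt a); rewrite inh_hc hya inh_tr mulKg iny fst_lt eqxx.
  by move=> /(_ isT).
- have := le 1; rewrite inh_hc h1 inh_tr mulg1 iny => /(_ isT).
  rewrite -cls_inv fst_cls => /first_split[w' e [s _]].
  have ey : y = cls (word_inv w') * (lt a)^-1.
    have: cls (word_inv (a :: w)) = cls (a :: w') by apply/clsP.
    by rewrite cls_inv -/y cls_cons => ei; rewrite -[LHS]invgK ei invgM cls_inv.
  have := hya; rewrite ey mulgVK iny fst_cls => /first_split[w2 e2 [s2 _]].
  have: size w < size w2.
    apply: (min (p * lt a)); rewrite -/y ey (iffRL (clsP _ _) e2) cls_cons.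
    by rewrite invgM !mulgA.
  move: s s2; rewrite /word_inv !size_rev !size_map /= => s s2.
  by rewrite ltnNge (leq_trans (ltnW s2)).
Qed.

(** All cyclic rotations of a shortest conjugate are shortest, so [shortest_skew] applies to every
    edge of its path. *)
Lemma skewered_product f : exists2 s, f = gprod s & forall h, h \in s -> skewers f h.
Proof.
have [p [w [-> min]]] := shortest_conj f; exists (edges p w).
  by rewrite gprod_edges.
move=> [q a] /mem_edges[w1 [w2 [/= ew ->]]]; left.
have e : p * cls w * p^-1 = p * cls w1 * cls (a :: w2 ++ w1) * (p * cls w1)^-1.
  by rewrite ew -cat_cons !clsM invgM !mulgA mulgK.
rewrite e; apply: shortest_skew => p' w'; rewrite -e => /min.
by rewrite ew size_cat /= size_cat addnS addnC.
Qed.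

Lemma skewers_nonempty f : (forall h, ~ skewers f h) -> f = 1.
Proof. by have [[|h s] -> //= sk no] := skewered_product f; case: (no h (sk h (mem_head _ _))). Qed.

Definition zpow f t := exists m, t = f ^+ m \/ t = f ^- m.

Lemma zpowV f t : zpow f t -> zpow f t^-1.
Proof. by case=> m [->|->]; exists m; [right|left; rewrite invgK]. Qed.

Lemma zpow_commute f t x : zpow f t -> commute x f -> commute x t.
Proof. by case=> m [->|->] xf; [|apply: commuteV]; apply: commuteX. Qed.

Lemma zpow_quot f m n : zpow f (f ^+ m / f ^+ n).
Proof.
have [le|/ltnW le] := leqP n m; first by exists (m - n)%N; left; rewrite expgnFr.
by exists (n - m)%N; right; rewrite expgnFr // invgF.
Qed.

Lemma zpowM f t t' : zpow f t -> zpow f t' -> zpow f (t * t').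
Proof.
case=> m [->|->] [n [->|->]].
- by exists (m + n)%N; left; rewrite expgnDr.
- exact: zpow_quot.
- have -> : f ^- m * f ^+ n = f ^+ n / f ^+ m; last exact: zpow_quot.
  by apply: commute_sym; apply/commuteV; apply: commuteX2.
- by exists (n + m)%N; right; rewrite expgnDr invgM.
Qed.

(** A power of [f] moves each [z ^+ n h] to a halfspace that contains [p] but not [f^-1 * p]. There
    are finitely many of these, so two exponents of [z] give the same one. *)
Lemma commensurable f z h : commute f z -> skewers f h ->
  exists i t, [/\ 0 < i, zpow f t & heq (tr (z ^+ i * t) h) h].
Proof.
move=> fk.
wlog sk : f fk / skew f h.
  move=> W [sk|sk]; first by apply: (W f fk sk); left.
  have [||i [t [i0 ft e]]] := W f^-1 _ sk; first exact/commute_sym/commuteV/commute_sym.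
    by left.
  exists i, t; split=> //; case: ft => m [->|->]; exists m; rewrite expVgn ?invgK; auto.
move=> _; pose p : G := 1; have [L HL] := separators (f^-1 * p) p.
have skn n : skew f (tr (z ^+ n) h) by apply: skewJ => //; apply/commute_sym/commuteX.
have [n|i [j [m [lt_ij [s fs es] [t ft et]]]]] := @pigeonhole _ L
   (fun n m => exists2 s, zpow f s & heq (tr (s * z ^+ n) h) m).
  have [N pN] := skew_in p (skn n).
  have skN : skew f (tr (f^-1 ^+ N) (tr (z ^+ n) h)).
    apply: skewJ (skn n); apply/commute_sym/commuteX/commuteV/commute_refl.
  have [M pM] := skew_out p skN.
  have [|j [nj ij]] := @first_step (fun j => ~~ inh (tr (f ^+ j) (tr (f^-1 ^+ N) (tr (z ^+ n) h))) p) M _ pM.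
    by rewrite tr1 negbK.
  rewrite negbK in nj.
  have [|//|m mL em] := HL (tr (f ^+ j) (tr (f^-1 ^+ N) (tr (z ^+ n) h))).
    by move: ij; rewrite expgS trM inh_tr.
  exists m => //; exists (f ^+ j * f^-1 ^+ N); last by rewrite -mulgA !trM.
  by rewrite expVgn; apply: zpow_quot.
exists (j - i)%N, (s^-1 * t); split; [by rewrite subn_gt0| |].
  by apply: zpowM => //; apply: zpowV.
have := heq_tr (s * z ^+ i)^-1 (heq_trans et (heq_sym es)).
rewrite trK -trM (_ : _ * _ = z ^+ (j - i) * (s^-1 * t)) //.
have zt : commute z (s^-1 * t).
  apply: zpow_commute (commute_sym fk); apply: zpowM => //; exact: zpowV.
rewrite expgnFr ?(ltnW lt_ij) // invgM -!mulgA (mulgA s^-1) (commuteX j (commute_sym zt)).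
rewrite !mulgA; congr (_ * _ * _).
exact: (commute_sym (commuteV (commuteX2 _ _ (commute_refl z)))).
Qed.

End Skewering.

(** * Moving a system of walls to the base point *)

Section Descent.
Variable g : sgraph.
Local Notation letter := (letter g).
Local Notation word := (word g).
Local Notation G := (raag g).
Local Notation hs := (hs g).
Variables (V : finType) (e : rel V) (comp pos : V -> nat).
Hypotheses (e_sym : symmetric e) (e_irr : irreflexive e).
Hypothesis comp_pos_inj : forall x y, comp x = comp y -> pos x = pos y -> x = y.
Hypothesis pos_pred : forall x, 0 < pos x -> exists y, comp y = comp x /\ pos y = (pos x).-1.
Hypothesis eE : forall x y, x != y ->
  ~~ e x y = (comp x == comp y) && ((pos x == (pos y).+1) || (pos y == (pos x).+1)).

(** A wall is kept together with a word leading to it, since the induction is on the total length of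
    these words. *)
Definition node := (word * letter)%type.
Definition wall (n : node) : hs := (cls n.1, n.2).
Implicit Types (h k : hs) (q : V -> node) (x y z : V) (c : letter).

Definition cmt h k := cl h * cl k == cl k * cl h.
(** Non-adjacent vertices need walls whose conjugated letters do not commute. At the base point this
    gives distinct vertices, while two copies of the same wall also fail to cross. *)
Definition rel_ok (b : bool) h k := if b then cross h k else ~~ cmt h k.
Definition conf q := forall x y, x != y -> rel_ok (e x y) (wall (q x)) (wall (q y)).

Lemma cmt_sym h k : cmt h k = cmt k h.
Proof. by rewrite /cmt eq_sym. Qed.

Lemma rel_ok_sym b h k : rel_ok b h k = rel_ok b k h.
Proof. by rewrite /rel_ok cross_sym cmt_sym. Qed.

Definition conj_by (f : G) h k := k.2.1 = h.2.1 /\ cl k = f * cl h * f^-1.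

Lemma cmt_conj f h h' k k' : conj_by f h h' -> conj_by f k k' -> cmt h' k' = cmt h k.
Proof.
move=> [_ eh] [_ ek]; rewrite /cmt eh ek !mulgA !mulgVK.
by rewrite (inj_eq (mulIg _)) -!(mulgA f) (inj_eq (mulgI _)).
Qed.

Lemma rel_ok_conj f b h h' k k' : conj_by f h h' -> conj_by f k k' ->
  rel_ok b h' k' = rel_ok b h k.
Proof.
move=> ch ck; rewrite /rel_ok /cross -[cl h' * _ == _]/(cmt h' k') (cmt_conj ch ck).
by rewrite ch.1 ck.1.
Qed.

Lemma conj_by_tr f h : conj_by f h (tr f h).
Proof. by split; rewrite ?cl_tr. Qed.

Lemma conj_by_comm c h : cmt h (1, c) -> conj_by (lt c)^-1 h h.
Proof.
rewrite /cmt /cl /= invg1 mulg1 mul1g => /eqP h_c; split=> //=.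
by rewrite invgK -mulgA h_c mulKg.
Qed.

(** Non-adjacency in [e] is adjacency in a linear forest, which has no triangle, no four-cycle and
    no vertex of degree three. This and the next two lemmas bound the bipartite graph between the
    two sides of a wall. *)
Lemma no_triangle x y z : x != y -> y != z -> x != z ->
  [|| e x y, e y z | e x z].
Proof.
move=> xy yz xz; rewrite -[_ || _]negbK !negb_or !eE //.
by apply/negP; lia.
Qed.

Lemma no_square x x' y y' : x != x' -> x != y -> x != y' -> x' != y -> x' != y' ->
  ~~ e x y -> ~~ e x y' -> ~~ e x' y -> ~~ e x' y' -> y = y'.
Proof.
move=> xx' xy xy' x'y x'y'; rewrite !eE // => H1 H2 H3 H4.
apply: comp_pos_inj; first by lia.
have : pos x <> pos x'; last by lia.
by move=> p; case/eqP: xx'; apply: comp_pos_inj => //; lia.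
Qed.

Lemma no_star x y y' z : x != y -> x != y' -> x != z -> y != y' -> y != z -> y' != z ->
  ~~ e x y -> ~~ e x y' -> e x z.
Proof.
move=> xy xy' xz yy' yz y'z xye xy'e; apply/negPn/negP; move: xye xy'e.
rewrite !eE // => H1 H2 H3.
have P u v : u != v -> comp u = comp v -> pos u <> pos v.
  by move=> uv cuv p; case/eqP: uv; apply: comp_pos_inj.
have := P _ _ yy'; have := P _ _ yz; have := P _ _ y'z; lia.
Qed.

Definition weight q := (\sum_x size (q x).1)%N.

Lemma weight_lt q q' x : (forall y, size (q' y).1 <= size (q y).1) ->
  size (q' x).1 < size (q x).1 -> weight q' < weight q.
Proof.
move=> le lt; rewrite /weight (bigD1 x) //= [ltnRHS](bigD1 x) //=.
by rewrite -addSn leq_add ?leq_sum.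
Qed.

(** * One step of the descent, at the wall of a letter [c] *)

Section Step.
Variables (q : V -> node) (c : letter) (T : V -> node).
Hypothesis q_conf : conf q.
Hypothesis T_wall : forall x, first c (q x).1 -> wall (T x) = tr (lt c)^-1 (wall (q x)).
Hypothesis T_size : forall x, first c (q x).1 -> size (T x).1 < size (q x).1.

(** Of the walls that do not commute with that of [c], [A] has those on the side of the base point
    and [B] those beyond. *)
Let C x := cmt (wall (q x)) (1, c).
Let A x := ~~ C x && ~~ first c (q x).1.
Let B x := ~~ C x && first c (q x).1.

Lemma step_AB x y : A x -> B y -> x != y /\ ~~ e x y.
Proof.
case/andP=> nCx fx /andP[nCy fy]; have xy : x != y by apply: contraNneq fx => ->.
split=> //; apply/negP => exy; have := q_conf xy; rewrite exy => /cross_side.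
move=> /(_ (1, c)); rewrite /inh /= invg1 !mul1g !fst_cls (negbTE fx) fy.
by move=> /(_ (elimN eqP nCx) (elimN eqP nCy)).
Qed.

(** A commuting wall that does not cross that of [c] is parallel to it, so it crosses neither [x0]
    nor [y0]. Together the three would form a triangle in the complement. *)
Lemma step_C x0 y0 z : A x0 -> B y0 -> C z -> cross (1, c) (wall (q z)).
Proof.
move=> Ax By Cz; have [xy exy] := step_AB Ax By.
have Cz' : commute (cl (1, c)) (cl (wall (q z))) by apply/esym/eqP.
have [//|[_ par]] := commute_cl Cz'.
have diff u : ~~ C u -> u != z /\ ~~ e u z.
  move=> nCu; have uz : u != z by apply: contraNneq nCu => ->.
  split=> //; apply/negP => euz; have := q_conf uz; rewrite euz => /andP[_ /eqP uz'].
  case/negP: nCu; apply/eqP; case: par => ->; first exact: uz'.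
  exact: commuteV.
have [xz exz] := diff _ (andP Ax).1; have [yz eyz] := diff _ (andP By).1.
by have := no_triangle xy yz xz; rewrite (negbTE exy) (negbTE exz) (negbTE eyz).
Qed.

Lemma trichotomy x : [\/ A x, B x | C x].
Proof.
rewrite /A /B; case: (C x) => /=; first by constructor 3.
by case: (first _ _); [constructor 2|constructor 1].
Qed.

Lemma conj_C x : C x -> conj_by (lt c)^-1 (wall (q x)) (wall (q x)).
Proof. exact: conj_by_comm. Qed.

Lemma conj_B x : B x -> conj_by (lt c)^-1 (wall (q x)) (wall (T x)).
Proof. by case/andP=> _ fx; rewrite T_wall //; apply: conj_by_tr. Qed.

Lemma conf_replace q' y : q' y = ([::], c) ->
  (forall x z, x != z -> x != y -> z != y -> rel_ok (e x z) (wall (q' x)) (wall (q' z))) ->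
  (forall z, z != y -> rel_ok (e y z) (1, c) (wall (q' z))) -> conf q'.
Proof.
move=> qy ok oky x z xz; case: (eqVneq x y) (eqVneq z y) => [ex|xy] [ez|zy].
- by rewrite ex ez eqxx in xz.
- by rewrite ex qy; apply: oky.
- by rewrite ez qy rel_ok_sym e_sym; apply: oky.
- exact: ok.
Qed.

Lemma step_noA y : B y -> (forall x, ~~ A x) -> exists2 q', conf q' & weight q' < weight q.
Proof.
move=> By nA; exists (fun x => if B x then T x else q x).
  move=> x z xz.
  have cj u : conj_by (lt c)^-1 (wall (q u)) (wall (if B u then T u else q u)).
    case: ifP => [|nB]; first exact: conj_B.
    by case: (trichotomy u) => [Au|Bu|]; [have := nA u; rewrite Au|rewrite Bu in nB|apply: conj_C].
  by rewrite (rel_ok_conj _ (cj x) (cj z)); apply: q_conf.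
apply: (@weight_lt _ _ y); last by rewrite By T_size //; case/andP: By.
by move=> x; case: ifP => // /andP[_ fx]; rewrite ltnW ?T_size.
Qed.

Lemma cmt_c_conj h k : conj_by (lt c)^-1 h k -> cmt (1, c) k = cmt h (1, c).
Proof.
move=> hk; rewrite cmt_sym; apply: (cmt_conj hk); split=> //.
by rewrite /cl /= invg1 invgK mulg1 mul1g mulVg mul1g.
Qed.

(** Two walls on the near side leave room for only one beyond, by [no_square]. The wall of [c] takes
    its place: [no_star] and [step_C] give the crossings with the commuting walls. *)
Lemma step_A2 x0 x1 y : A x0 -> A x1 -> x0 != x1 -> B y ->
  exists2 q', conf q' & weight q' < weight q.
Proof.
move=> A0 A1 x01 By; have [x0y e0y] := step_AB A0 By; have [x1y e1y] := step_AB A1 By.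
exists (fun x => if x == y then ([::], c) else q x).
  apply: (@conf_replace _ y); first by rewrite eqxx.
    by move=> x z xz /negbTE -> /negbTE ->; apply: q_conf.
  move=> z zy; rewrite (negbTE zy); case: (trichotomy z) => [Az|Bz|Cz].
  - have [_] := step_AB Az By; rewrite e_sym => /negbTE-> /=; rewrite cmt_sym.
    by case/andP: Az.
  - have [x0z e0z] := step_AB A0 Bz; have [x1z e1z] := step_AB A1 Bz.
    by case/eqP: zy; apply: (@no_square x0 x1).
  - have -> : e y z; last exact: step_C A0 By Cz.
    have zx u : A u -> u != z by move=> /andP[nC _]; apply: contraNneq nC => ->.
    have x0z := zx _ A0; have x1z := zx _ A1.
    by apply: (@no_star y x0 x1); rewrite // 1?eq_sym // 1?e_sym.
apply: (@weight_lt _ _ y); first by move=> x; case: ifP.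
rewrite eqxx /=; case/andP: By => _; case: (q y).1 => //=.
by rewrite first_nil.
Qed.

(** Dually, only one wall is on the near side. It is replaced by the wall of [c], and all walls
    beyond are translated. *)
Lemma step_B2 x y0 y1 : A x -> B y0 -> B y1 -> y0 != y1 ->
  exists2 q', conf q' & weight q' < weight q.
Proof.
move=> Ax B0 B1 y01; have [xy0 e0] := step_AB Ax B0; have [xy1 e1] := step_AB Ax B1.
have uniqA z : A z -> z = x.
  move=> Az; apply/eqP/negPn/negP => zx; case/eqP: y01.
  have [zy0 ez0] := step_AB Az B0; have [zy1 ez1] := step_AB Az B1.
  exact: (@no_square z x).
exists (fun z => if z == x then ([::], c) else if B z then T z else q z).
  have cj z : z != x -> conj_by (lt c)^-1 (wall (q z)) (wall (if B z then T z else q z)).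
    move=> zx; case: ifP => [|nB]; first exact: conj_B.
    by case: (trichotomy z) => [/uniqA/eqP|Bz|]; [rewrite (negbTE zx)|rewrite Bz in nB|apply: conj_C].
  apply: (@conf_replace _ x); first by rewrite eqxx.
    move=> z z' zz' zx zx'; rewrite (negbTE zx) (negbTE zx').
    by rewrite (rel_ok_conj _ (cj z zx) (cj z' zx')); apply: q_conf.
  move=> z zx; rewrite (negbTE zx); case: (trichotomy z) => [/uniqA/eqP|Bz|Cz].
  - by rewrite (negbTE zx).
  - have [_ /negbTE-> /=] := step_AB Ax Bz; rewrite Bz (cmt_c_conj (conj_B Bz)).
    by case/andP: Bz.
  - have yz u : B u -> u != z by move=> /andP[nC _]; apply: contraNneq nC => ->.
    have nB : B z = false by rewrite /B Cz.
    have y0z := yz _ B0; have y1z := yz _ B1.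
    rewrite nB (@no_star x y0 y1) // 1?eq_sym //; exact: step_C Ax B0 Cz.
apply: (@weight_lt _ _ y0).
  by move=> z; case: ifP => //; case: ifP => // /andP[_ fz]; rewrite ltnW ?T_size.
by rewrite eq_sym (negbTE xy0) B0 T_size //; case/andP: B0.
Qed.

Section Single.
Variables x0 y0 : V.
Hypotheses (A0 : A x0) (B0 : B y0).
Hypotheses (A1 : forall x, A x -> x = x0) (B1 : forall y, B y -> y = y0).

Let q1 z := if z == y0 then T y0 else q z.

Lemma single_C z : z != x0 -> z != y0 -> C z.
Proof. by case: (trichotomy z) => [/A1->|/B1->|//]; rewrite eqxx. Qed.

(** When [y0] alone is translated, the pair of [x0] and [y0] is the only one that can go wrong. *)
Lemma single_conf x z : x != z -> [|| x != x0, z != y0 | ~~ cmt (wall (q x0)) (wall (T y0))] ->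
  [|| x != y0, z != x0 | ~~ cmt (wall (q x0)) (wall (T y0))] ->
  rel_ok (e x z) (wall (q1 x)) (wall (q1 z)).
Proof.
have [x0y0 e0] := step_AB A0 B0.
wlog zy : x z / x != y0.
  move=> W xz H1 H2; case: (eqVneq x y0) => [ex|xy]; last exact: W.
  have zy : z != y0 by rewrite -ex eq_sym.
  rewrite rel_ok_sym e_sym; apply: W => //; first by rewrite eq_sym.
    by rewrite orbCA.
  by rewrite zy.
move=> xz H1 _; rewrite /q1 (negbTE zy); case: (eqVneq z y0) => [ez|zy']; last exact: q_conf.
rewrite ez in xz H1 *; case: (eqVneq x x0) H1 => [-> /=|xx0 _].
  by rewrite eqxx (negbTE e0).
have Cx := single_C xx0 zy.
by rewrite (rel_ok_conj _ (conj_C Cx) (conj_B B0)); apply: q_conf.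
Qed.

Lemma weight_q1 : weight q1 < weight q.
Proof.
have f0 : first c (q y0).1 by case/andP: B0.
apply: (@weight_lt _ _ y0); last by rewrite /q1 eqxx T_size.
by move=> z; rewrite /q1; case: eqP => // ->; rewrite ltnW ?T_size.
Qed.

Lemma step_move : ~~ cmt (wall (q x0)) (wall (T y0)) ->
  exists2 q', conf q' & weight q' < weight q.
Proof.
by move=> nc; exists q1; [move=> x z xz; apply: single_conf; rewrite // nc !orbT|exact: weight_q1].
Qed.

(** Here the wall of [c] can replace that of [y0]. A commuting [z] not adjacent to [y0] would be
    adjacent to [x0], so its wall would commute with that of [x0], hence with the parallel [T y0],
    and so with the old wall of [y0]. *)
Lemma step_parallel :
  cl (wall (q x0)) = cl (wall (T y0)) \/ cl (wall (q x0)) = (cl (wall (T y0)))^-1 ->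
  exists2 q', conf q' & weight q' < weight q.
Proof.
move=> par; have [xy e0] := step_AB A0 B0.
exists (fun z => if z == y0 then ([::], c) else q z).
  apply: (@conf_replace _ y0); first by rewrite eqxx.
    by move=> x z xz /negbTE-> /negbTE->; apply: q_conf.
  move=> z zy; rewrite (negbTE zy); case: (eqVneq z x0) => [->|zx].
    by rewrite e_sym (negbTE e0) /= cmt_sym; case/andP: A0.
  have Cz := single_C zx zy.
  rewrite (_ : e y0 z); first exact: step_C A0 B0 Cz.
  apply/negPn/negP => ne; have := no_triangle xy _ _ => /(_ z).
  rewrite (negbTE e0) (negbTE ne) 1?eq_sym => /(_ zy).
  rewrite eq_sym => /(_ zx) /= exz.
  have := q_conf zy; rewrite e_sym (negbTE ne) /= => /negP; apply.
  rewrite -(cmt_conj (conj_C Cz) (conj_B B0)).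
  have := q_conf zx; rewrite e_sym exz => /andP[_].
  rewrite /cmt => /eqP zx0; apply/eqP; case: par => ep; first by rewrite -ep.
  by rewrite -[cl (wall (T y0))]invgK -ep; apply: commuteV.
have := B0; rewrite /B => /andP[_ f0].
apply: (@weight_lt _ _ y0); first by move=> x; case: ifP.
by rewrite eqxx; case: (q y0).1 f0 => //=; rewrite first_nil.
Qed.

(* The walls of [x0] and [T y0] now cross: insert the wall of [c] between them
   and shift the rest of the path by one position, forgetting its last wall. *)
Lemma step_insert : cross (wall (q x0)) (wall (T y0)) ->
  exists2 q', conf q' & weight q' < weight q.
Proof.
move=> cr; have [xy e0] := step_AB A0 B0.
have [u [v [ev cuv puv]]] : exists u v, [/\ (u = x0 /\ v = y0) \/ (u = y0 /\ v = x0),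
    comp u = comp v & pos v = (pos u).+1].
  move: e0; rewrite eE // => /andP[/eqP cxy /orP[]/eqP p]; first by exists y0, x0; split; auto.
  by exists x0, y0; split; auto.
have [|pr prP] := @fin_all_exists V (fun=> V)
    (fun z y => 0 < pos z -> comp y = comp z /\ pos y = (pos z).-1).
  move=> z; case: (posnP (pos z)) => [->|p]; first by exists z.
  by have [y yP] := pos_pred p; exists y.
(* The wall of [c] goes to [v], the later of the two vertices, and each vertex beyond [v] takes the
   wall of its predecessor. *)
pose far z := (comp z == comp v) && (pos v < pos z).
pose s z := if far z then pr z else z.
have sE z : z != v -> comp (s z) = comp z /\
    pos (s z) = if far z then (pos z).-1 else pos z.
  rewrite /s; case Ez: (far z) => // _; case/andP: Ez => _ pz.
  by apply: prP; apply: leq_ltn_trans pz.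
have s_inj : {in [pred z | z != v] &, injective s}.
  move=> y z yv zv syz; have [cy py] := sE y yv; have [cz pz] := sE z zv.
  have ny : comp y = comp v -> pos y <> pos v by move=> c' p'; case/eqP: yv; apply: comp_pos_inj.
  have nz : comp z = comp v -> pos z <> pos v by move=> c' p'; case/eqP: zv; apply: comp_pos_inj.
  rewrite syz in cy py; apply: comp_pos_inj; first by rewrite -cy.
  by move: py pz; rewrite /far -cy -cz; do !case: ifP; lia.
have eqE2 a b : (a == b) = (comp a == comp b) && (pos a == pos b).
  apply/eqP/andP => [->|[/eqP ec /eqP]]; [by rewrite !eqxx|exact: comp_pos_inj].
pose q' z := if z == v then ([::], c) else q1 (s z).
have q1uv : cross (wall (q1 u)) (wall (q1 v)).
  by rewrite /q1; case: ev => -[-> ->]; rewrite eqxx (negbTE xy) // cross_sym.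
exists q'.
  apply: (@conf_replace _ v); first by rewrite /q' eqxx.
    move=> y z yz yv zv; rewrite /q' (negbTE yv) (negbTE zv).
    have syz : s y != s z by apply: contraNneq yz => /s_inj; rewrite !inE => ->.
    have [cy py] := sE y yv; have [cz pz] := sE z zv.
    (* The shift preserves [e] except for the pair mapped to [u] and [v]: these were neighbours on
       the path, and the inserted vertex now separates them. *)
    have excE : ((s y == u) && (s z == v) || (s y == v) && (s z == u)) || (e y z == e (s y) (s z)).
      move: yv zv; rewrite -(inj_eq negb_inj) !eE // !eqE2 cy cz py pz /far.
      rewrite cuv puv; case: (eqVneq (comp y) (comp v)) => [ey|ncy];
        case: (eqVneq (comp z) (comp v)) => [ez|ncz]; rewrite ?ey ?ez ?eqxx //=.
      - case: (ltnP _ (pos y)); case: (ltnP _ (pos z)); clear; lia.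
      - by rewrite !andbF /= (eq_sym (comp v)) (negbTE ncz).
      - by rewrite (negbTE ncy).
    case: (boolP (((s y == u) && (s z == v)) || ((s y == v) && (s z == u)))) excE => /= [exc _|nexc /eqP->].
      have -> : e y z.
        apply/negPn; rewrite eE //; move: exc yv zv; rewrite !eqE2 cy cz py pz /far cuv puv.
        case: (eqVneq (comp y) (comp v)) => [ey|ncy]; rewrite ?andbF //=.
        case: (eqVneq (comp z) (comp v)) => [ez|ncz]; rewrite ?andbF //= ey ez eqxx /=.
        by case: (ltnP _ (pos y)); case: (ltnP _ (pos z)); clear; lia.
      by case/orP: exc => /andP[/eqP-> /eqP->]; rewrite // [rel_ok _ _ _]cross_sym.
    apply: single_conf => //.
      by move: nexc; case: ev => -[-> ->]; case: (s y == x0); case: (s z == y0); rewrite ?orbT.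
    by move: nexc; case: ev => -[-> ->]; case: (s y == y0); case: (s z == x0); rewrite ?orbT.
  move=> z zv; rewrite /q' (negbTE zv); have [cz pz] := sE z zv.
  have [szuv|szuv] := boolP ((s z == u) || (s z == v)).
    have -> : e v z = false.
      apply/negbTE; rewrite eE 1?eq_sym //; move: szuv zv; rewrite !eqE2 cz pz /far cuv puv.
      case: (eqVneq (comp z) (comp v)) => [ez|ncz] //=; rewrite ?ez ?eqxx /=.
      by case: (ltnP _ (pos z)); clear; lia.
    have : (s z == x0) || (s z == y0) by case: ev szuv => -[-> ->]; rewrite // orbC.
    rewrite /rel_ok /q1; case/orP=> /eqP->; first by rewrite (negbTE xy) cmt_sym; case/andP: A0.
    by rewrite eqxx (cmt_c_conj (conj_B B0)); case/andP: B0.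
  have -> : e v z.
    apply/negPn; rewrite eE 1?eq_sym //; move: szuv zv; rewrite !eqE2 cz pz /far cuv puv.
    case: (eqVneq (comp z) (comp v)) => [ez|ncz] //=; rewrite ?ez ?eqxx /=.
    by case: (ltnP _ (pos z)); clear; lia.
  have [szx szy] : s z != x0 /\ s z != y0.
    by move: szuv; rewrite negb_or; case: ev => -[-> ->] /andP[-> ->].
  by rewrite /q1 (negbTE szy); apply: step_C A0 B0 _; apply: single_C.
(* The wall of [c] has the empty word and [s] is injective away from [v], so the new weight is at
   most that of [q1]. *)
apply: leq_trans weight_q1; rewrite ltnS /weight (bigD1 v) //= {1}/q' eqxx add0n.
rewrite (eq_bigr (fun z => size (q1 (s z)).1)); last by move=> z /negbTE; rewrite /q' => ->.
rewrite -(@big_imset _ _ _ V V s [pred z | z != v] (fun z => size (q1 z).1)) //.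
by rewrite [leqRHS](bigID (mem (s @: [pred z | z != v]))) /= leq_addr.
Qed.

End Single.

Lemma step y : B y -> exists2 q', conf q' & weight q' < weight q.
Proof.
move=> By; case: (boolP [exists x, A x]) => [/existsP[x Ax]|/existsPn nA]; last exact: (step_noA By).
case: (boolP [exists x', A x' && (x != x')]) => [/existsP[x' /andP[Ax' xx']]|/existsPn uA].
  exact: step_A2 Ax Ax' xx' By.
case: (boolP [exists y', B y' && (y != y')]) => [/existsP[y' /andP[By' yy']]|/existsPn uB].
  exact: step_B2 Ax By By' yy'.
have A1 z : A z -> z = x.
  by move=> Az; have := uA z; rewrite Az negbK => /eqP.
have B1 z : B z -> z = y.
  by move=> Bz; have := uB z; rewrite Bz negbK => /eqP.
have [cm|] := boolP (cmt (wall (q x)) (wall (T y))); last exact: step_move.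
have [cr|[_ par]] := commute_cl (eqP cm); first exact: step_insert Ax By A1 B1 cr.
exact: step_parallel Ax By A1 B1 par.
Qed.

End Step.

Lemma descent_step q x : conf q -> 0 < size (q x).1 -> exists2 q', conf q' & weight q' < weight q.
Proof.
move=> cq; case e_qx : (q x).1 => [//|c p] _.
have upd p' : cls p' = cls (q x).1 -> size p' < size (q x).1 ->
    exists2 q', conf q' & weight q' < weight q.
  move=> ep sp; exists (fun y => if y == x then (p', (q x).2) else q y).
    have ew y : wall (if y == x then (p', (q x).2) else q y) = wall (q y).
      by case: eqP => // ->; rewrite /wall ep.
    by move=> y z yz; rewrite !ew; apply: cq.
  by apply: (@weight_lt _ _ x); [move=> y; case: eqP => // ->; exact: ltnW|rewrite eqxx].
have [fc|nfc] := boolP (first c (q x).1); last first.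
  move: nfc; rewrite e_qx first_same negbK => /first_split[p' ep [sp _]].
  apply: (upd p'); last by rewrite e_qx ltnW // ltnS.
  rewrite e_qx; apply/esym/clsP.
  exact: requ_trans (requ_cons c ep) (requ_free _ _).
have [|T TP] := @fin_all_exists V (fun=> node) (fun y n => first c (q y).1 ->
    wall n = tr (lt c)^-1 (wall (q y)) /\ size n.1 < size (q y).1).
  move=> y; have [/first_split[p' ep [sp _]]|_] := boolP (first c (q y).1); last first.
    by exists ([::], c).
  exists (p', (q y).2) => _; split=> //.
  by rewrite /tr /wall /= ; congr pair; rewrite (iffRL (clsP _ _) ep) cls_cons mulKg.
have [cx|ncx] := boolP (cmt (wall (q x)) (1, c)); last first.
  apply: (@step q c T cq _ _ x); last by rewrite ncx.
    by move=> y /TP[].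
  by move=> y /TP[].
(* The wall of [x] commutes with that of [c], so translating it alone does not change its conjugated
   letter. *)
exists (fun y => if y == x then T x else q y).
  have [eT _] := TP x fc.
  have ew y : conj_by 1 (wall (q y)) (wall (if y == x then T x else q y)).
    case: eqP => [->|_]; last by split; rewrite // mul1g invg1 mulg1.
    have [_ ec] := conj_by_comm cx.
    by rewrite eT; split=> //; rewrite cl_tr -ec mul1g invg1 mulg1.
  by move=> y z yz; rewrite (rel_ok_conj _ (ew y) (ew z)); apply: cq.
apply: (@weight_lt _ _ x); last by rewrite eqxx; have [] := TP x fc.
by move=> y; case: eqP => // ->; have [_ /ltnW] := TP x fc.
Qed.

Lemma conf_embedding (h : V -> hs) :
  (forall x y, x != y -> rel_ok (e x y) (h x) (h y)) ->
  exists f : V -> g, injective f /\ forall x y, adj (f x) (f y) = e x y.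
Proof.
move=> ch; have [q cq] : exists q, conf q.
  exists (fun x => (repr (h x).1, (h x).2)) => x y xy.
  by rewrite /wall /= !cls_repr -!surjective_pairing; apply: ch.
elim: {q}_.+1 {-2}q (ltnSn (weight q)) cq => // n IH q ltn cq.
have [/existsP[x nx]|/existsPn nil] := boolP [exists x, 0 < size (q x).1].
  by have [q' cq' lt] := descent_step cq nx; apply: (IH q') => //; apply: leq_trans lt _.
have wq x : wall (q x) = (1, (q x).2).
  by have := nil x; rewrite lt0n negbK /wall => /nilP->.
exists (fun x => (q x).2.1).
have ok x y : x != y -> (q x).2.1 != (q y).2.1 /\ adj (q x).2.1 (q y).2.1 = e x y.
  move=> /cq; rewrite !wq /rel_ok; case: (e x y).
    by move=> /andP[/= xy _]; split=> //; apply: contraTneq xy => ->; rewrite adj_irr.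
  rewrite /cmt /cl /= !invg1 !mulg1 !mul1g => nc; split.
    apply: contraNneq nc; case: (q x).2 (q y).2 => v b [w b'] /= <-.
    have [->|nbb] := eqVneq b b'; first by [].
    have -> : (v, b') = linv (v, b) by rewrite /linv /=; case: b b' nbb => [] [].
    by rewrite lt_linv mulgV mulVg.
  by apply/negP => /(@lt_comm g)/eqP; apply/negP.
split=> [x y exy|x y]; first by apply/eqP/negPn/negP => /ok[]; rewrite exy eqxx.
by case: (eqVneq x y) => [->|/ok[]//]; rewrite adj_irr e_irr.
Qed.

End Descent.

(** * Evaluation of words and splitting into blocks *)

Section Evaluation.
Variables (G : groupType) (V : Type).
Implicit Types (f : V -> G) (w : word V).

Definition ev f w : G :=
  foldr (fun l x => (if l.2 then f l.1 else (f l.1)^-1) * x) 1 w.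

Lemma ev_cat f w w' : ev f (w ++ w') = ev f w * ev f w'.
Proof. by elim: w => [|l w IH] /=; rewrite ?mul1g // IH mulgA. Qed.

Lemma ev_seq1 f v b : ev f [:: (v, b)] = if b then f v else (f v)^-1.
Proof. by rewrite /= mulg1. Qed.

Lemma ev_inv f w : ev f (word_inv w) = (ev f w)^-1.
Proof.
elim: w => [|[v b] w IH]; first by rewrite /= invg1.
rewrite /word_inv /= rev_cons -cats1 ev_cat [ev f (rev _)]IH ev_seq1 /= invgM.
by case: b; rewrite ?invgK.
Qed.

Lemma ev_nseq f v b n : ev f (nseq n (v, b)) = (if b then f v else (f v)^-1) ^+ n.
Proof. by elim: n => //= n ->; rewrite expgS. Qed.

Definition word_comm w w' := word_inv w ++ word_inv w' ++ w ++ w'.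

Lemma ev_comm f w w' : ev f (word_comm w w') = [~ ev f w, ev f w'].
Proof. by rewrite !ev_cat !ev_inv /commg /conjg. Qed.

Lemma ev_mul f f1 f2 w : (forall x y, commute (f1 x) (f2 y)) ->
  (forall x, f x = f1 x * f2 x) -> ev f w = ev f1 w * ev f2 w.
Proof.
move=> c12 ef.
have cw x w' : commute (f2 x) (ev f1 w').
  elim: w' => [|[y b] w' IH] /=; first exact: commute1.
  apply: commuteM => //; case: b; last apply: commuteV; exact/commute_sym.
elim: w => [|[x b] w IH] /=; first by rewrite mul1g.
have [-> c2] : (if b then f x else (f x)^-1) =
    (if b then f1 x else (f1 x)^-1) * (if b then f2 x else (f2 x)^-1) /\
    commute (if b then f2 x else (f2 x)^-1) (ev f1 w).
  case: b; rewrite ef; split=> //; first by rewrite c12 invgM.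
  exact/commute_sym/commuteV/commute_sym.
by rewrite IH -!mulgA; congr (_ * _); rewrite !mulgA c2.
Qed.

End Evaluation.

Lemma cls_subst (g : sgraph) (V : Type) (f : V -> word g) (w : word V) :
  cls (word_subst f w) = ev (fun x => cls (f x)) w.
Proof.
elim: w => [|[v b] w IH]; first by [].
by rewrite /word_subst /= clsM [cls (flatten _)]IH; case: b; rewrite // cls_inv.
Qed.

(** * Elements that fix halfspaces *)

Section Fixing.
Variable g : sgraph.
Local Notation G := (raag g).
Local Notation hs := (hs g).
Implicit Types (f t : G) (h k : hs) (s : seq hs).

Definition fixes f k := heq (tr f k) k.

Lemma fixes1 k : fixes 1 k. Proof. by rewrite /fixes tr1. Qed.
Lemma fixesM f f' k : fixes f k -> fixes f' k -> fixes (f * f') k.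
Proof. by move=> ff ff'; rewrite /fixes trM; apply: heq_trans (heq_tr _ ff') ff. Qed.
Lemma fixesV f k : fixes f k -> fixes f^-1 k.
Proof. by move=> ff; apply: heq_sym; rewrite -{1}(trK f k); apply: heq_tr. Qed.

Lemma fixes_gprod s k : (forall h, h \in s -> fixes (cl h) k) -> fixes (gprod s) k.
Proof.
elim: s => [|h s IH] fs /=; first exact: fixes1.
apply: fixesM; first by apply: fs; rewrite mem_head.
by apply: IH => h' hs'; apply: fs; rewrite inE hs' orbT.
Qed.

Lemma fixes_ev (V : eqType) (f : V -> G) (w : word V) k :
  (forall l, l \in w -> fixes (f l.1) k) -> fixes (ev f w) k.
Proof.
elim: w => [|l w IH] fw /=; first exact: fixes1.
apply: fixesM; last by apply: IH => l' lw; apply: fw; rewrite inE lw orbT.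
have fl : fixes (f l.1) k by apply: fw; rewrite mem_head.
by case: (l.2) => //; apply: fixesV.
Qed.

Lemma commute_gprod s s' : (forall h k, h \in s -> k \in s' -> commute (cl h) (cl k)) ->
  commute (gprod s) (gprod s').
Proof.
move=> c; have c1 h : h \in s -> commute (cl h) (gprod s').
  move=> hs; elim: s' c => [|k s' IH] c /=; first exact: commute1.
  apply: commuteM; first by apply: c; rewrite ?mem_head.
  by apply: IH => h' k' hs' ks'; apply: c; rewrite // inE ks' orbT.
elim: s {c} c1 => [|h s IH] c /=; first exact: (commute_sym (commute1 _)).
apply: commute_sym; apply: commuteM; first by apply/commute_sym/c; rewrite mem_head.
by apply/commute_sym/IH => h' hs'; apply: c; rewrite inE hs' orbT.
Qed.

Lemma cross_commute h k : cross h k -> commute (cl h) (cl k).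
Proof. by case/andP=> _ /eqP. Qed.

Lemma cross_irr h : cross h h = false.
Proof. by rewrite /cross adj_irr. Qed.

Lemma gprod_split s (P : pred hs) :
  (forall h k, h \in s -> k \in s -> P h -> ~~ P k -> cross h k) ->
  gprod s = gprod (filter P s) * gprod (filter (predC P) s).
Proof.
elim: s => [|h s IH] c /=; first by rewrite mulg1.
rewrite IH; last by move=> a b a_s b_s; apply: c; rewrite inE ?a_s ?b_s orbT.
case Ph: (P h) => /=; first by rewrite mulgA.
have ch : commute (cl h) (gprod (filter P s)).
  rewrite -[cl h]mulg1; apply: (@commute_gprod [:: h]) => a b; rewrite inE => /eqP->.
  rewrite mem_filter => /andP[Pb bs]; apply/commute_sym/cross_commute/c => //.
  - by rewrite inE bs orbT.
  - by rewrite mem_head.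
  - by rewrite Ph.
by rewrite mulgA ch -mulgA.
Qed.

(* An element of the group generated by the letters of [L] that fixes all the
   walls of [L] is trivial: any wall it skewers would cross all of [L], hence be
   fixed by the letters of [L]. *)
Lemma generated_fix (L : hs -> Prop) t :
  (forall k, (forall h, L h -> fixes (cl h) k) -> fixes t k) ->
  (forall h, L h -> fixes t h) -> t = 1.
Proof.
move=> gen fixL; apply: skewers_nonempty => k sk.
apply: (skewers_neq sk); apply: gen => h Lh.
by apply: cross_fix; apply: fix_cross (fixL h Lh) sk.
Qed.

End Fixing.

Lemma connect_ind (T : finType) (r : rel T) (P : T -> Prop) x :
  P x -> (forall a b, connect r x a -> P a -> r a b -> P b) ->
  forall y, connect r x y -> P y.
Proof.
move=> Px step y /connectP[p]; elim/last_ind: p y => [|p z IH] y; first by move=> _ ->.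
rewrite rcons_path last_rcons => /andP[rp rz] ->.
apply: step rz; last exact: IH.
by apply/connectP; exists p.
Qed.

Lemma induced_path (T : finType) (r : rel T) x y : connect r x y ->
  exists (c : nat -> T) (m : nat), [/\ c 0 = x, c m = y,
    forall i, i < m -> r (c i) (c i.+1) &
    forall i j, i.+1 < j -> j <= m -> ~~ r (c i) (c j)].
Proof.
move=> /connectP[p0 rp0 ey].
pose W n := exists c : nat -> T, [/\ c 0 = x, c n = y & forall i, i < n -> r (c i) (c i.+1)].
have W0 : W (size p0).
  exists (fun i => nth x (x :: p0) i); split=> //; first by rewrite -last_nth.
  by move=> i ip; have /(pathP x) := rp0; apply.
have [m [c [c0 cm cS]] min] := least_nat W0.
exists c, m; split=> // i j ij jm; apply/negP => rij.
suff /min : W (m - (j - i.+1))%N by lia.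
exists (fun k => if k <= i then c k else c (k + (j - i.+1))%N); split=> //.
  by rewrite ifF; [rewrite subnK //; lia|lia].
move=> k km; have [ki|ik] := leqP k i; last by rewrite ifF; [apply: cS; lia|lia].
have [lt|eq] := ltnP k i; first by apply: cS; lia.
have -> : k = i by apply/eqP; rewrite eqn_leq ki.
by rewrite (subnKC (ltnW ij)).
Qed.

(** * Blocks of walls and the parts of the images in them *)

Section Selection.
Variable g : sgraph.
Local Notation G := (raag g).
Local Notation hs := (hs g).
Variables (V : finType) (e : rel V) (f : V -> G) (s : V -> seq hs).
Hypotheses (e_sym : symmetric e) (e_irr : irreflexive e).
Hypothesis f_comm : forall x y, e x y -> commute (f x) (f y).
Hypothesis f_gprod : forall x, f x = gprod (s x).
Hypothesis s_skew : forall x h, h \in s x -> skewers (f x) h.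
Implicit Types (h k : hs) (x y z : V) (w : word V).

Local Notation sk x h := (skewers (f x) h).

Lemma share x y h k : e x y -> sk x h -> sk y k -> ~~ cross h k -> sk y h /\ sk x k.
Proof. by move/f_comm; apply: skewers_share. Qed.

Definition gpart (P : pred hs) x := gprod (filter P (s x)).

Definition separating (P : pred hs) := forall x y h k,
  h \in s x -> k \in s y -> P h -> ~~ P k -> cross h k.

Lemma ev_part P w : separating P -> ev f w = ev (gpart P) w * ev (gpart (predC P)) w.
Proof.
move=> sep; apply: ev_mul => [x y|x].
  apply: commute_gprod => h k; rewrite !mem_filter => /andP[Ph hx] /andP[Pk ky].
  by apply: cross_commute; apply: sep hx ky Ph Pk.
by rewrite f_gprod; apply: gprod_split => h k; apply: sep.
Qed.

Lemma fixes_part_other P w h x : separating P -> h \in s x -> P h ->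
  fixes (ev (gpart (predC P)) w) h.
Proof.
move=> sep hx Ph; apply: fixes_ev => l _; apply: fixes_gprod => k.
rewrite mem_filter => /andP[Pk kl]; apply: cross_fix; rewrite cross_sym.
exact: sep hx kl Ph Pk.
Qed.

(** The part outside [P] fixes the walls in [P], which cross all of its own. Hence the part inside
    fixes the walls of its letters and is trivial by [generated_fix]. *)
Lemma part_kill P w : separating P ->
  (forall l h, l \in w -> h \in s l.1 -> P h -> fixes (ev f w) h) -> ev (gpart P) w = 1.
Proof.
move=> sep fx.
apply: (@generated_fix _ (fun h => P h /\ exists2 l, l \in w & h \in s l.1)).
  move=> k fk; apply: fixes_ev => l lw; apply: fixes_gprod => h.
  by rewrite mem_filter => /andP[Ph hl]; apply: fk; split=> //; exists l.
move=> h [Ph [l lw hl]].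
rewrite -(mulgK (ev (gpart (predC P)) w) (ev (gpart P) w)) -ev_part //.
by apply: fixesM; [apply: fx hl Ph|apply/fixesV/(fixes_part_other _ sep hl Ph)].
Qed.

Lemma part_commute P x y : separating P -> e x y -> commute (gpart P x) (gpart P y).
Proof.
move=> sep /f_comm cxy.
have : ev (gpart P) (word_comm [:: (x, true)] [:: (y, true)]) = 1.
  apply: part_kill => // l h _ _ _; rewrite ev_comm !ev_seq1.
  by move/commgP/eqP: cxy => ->; apply: fixes1.
by rewrite ev_comm !ev_seq1 => /eqP/commgP.
Qed.

Definition walls := undup (flatten [seq s x | x <- enum V]).

Lemma mem_walls h : h \in walls -> exists x, h \in s x.
Proof. by rewrite mem_undup => /flattenP[_ /mapP[x _ ->] hx]; exists x. Qed.

Lemma walls_mem x h : h \in s x -> h \in walls.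
Proof.
move=> hx; rewrite mem_undup; apply/flattenP; exists (s x) => //.
by apply/mapP; exists x; rewrite ?mem_enum.
Qed.

Definition wnode := seq_sub walls.
Definition noncross : rel wnode := fun i j => ~~ cross (ssval i) (ssval j).
(** A block is made a predicate on all halfspaces, false outside [walls], so that it can filter the
    lists [s x]. *)
Definition wblock (i : wnode) : pred hs :=
  fun h => if insub h is Some j then connect noncross i j else false.

Lemma noncross_sym : symmetric noncross.
Proof. by move=> i j; rewrite /noncross cross_sym. Qed.

Lemma block_node i j : wblock i (ssval j) = connect noncross i j.
Proof. by rewrite /wblock valK. Qed.

Lemma node_of x h : h \in s x -> exists j : wnode, ssval j = h.
Proof. by move=> /walls_mem hw; exists (SeqSub hw). Qed.

Lemma wnode_own (j : wnode) : exists2 x, ssval j \in s x & sk x (ssval j).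
Proof. by have [x hx] := mem_walls (ssvalP j); exists x; last exact: s_skew. Qed.

Lemma block_sep i : separating (wblock i).
Proof.
move=> x y h k /node_of[a <-] /node_of[b <-]; rewrite !block_node => ia ib.
apply: contraR ib => ab; exact: connect_trans ia (connect1 ab).
Qed.

Lemma connect_block i j j' : connect noncross i j -> connect noncross i j' ->
  connect noncross j j'.
Proof.
move=> ij ij'; apply: connect_trans ij'.
by rewrite (sym_connect_sym noncross_sym).
Qed.

Lemma ev_blocks w : (forall i, ev (gpart (wblock i)) w = 1) -> ev f w = 1.
Proof.
move=> w1; apply: (@generated_fix _ (fun h => exists x, h \in s x)).
  move=> k fk; apply: fixes_ev => l _; rewrite f_gprod; apply: fixes_gprod => h hl.
  by apply: fk; exists l.1.
move=> h [x hx]; have [i ei] := node_of hx.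
rewrite (ev_part _ (@block_sep i)) w1 mul1g; apply: fixes_part_other hx _.
  exact: block_sep.
by rewrite -ei block_node.
Qed.

(** If the next wall is skewered by [x], [y] or a vertex adjacent to one of them, [share] carries
    the skewering over. Thus it propagates along chains of non-crossing walls. *)
Lemma spread x y i : e x y -> (forall z, [|| z == x, z == y, e z x | e z y]) ->
  sk x (ssval i) -> sk y (ssval i) ->
  forall j, connect noncross i j -> sk x (ssval j) /\ sk y (ssval j).
Proof.
move=> exy far xi yi; apply: connect_ind => // a b _ [xa ya] ab.
have [z _ zb] := wnode_own b; have eyx : e y x by rewrite e_sym.
have sx : sk x (ssval b) -> sk x (ssval b) /\ sk y (ssval b).
  by move=> xb; split=> //; have [] := share eyx ya xb ab.
have sy : sk y (ssval b) -> sk x (ssval b) /\ sk y (ssval b).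
  by move=> yb; split=> //; have [] := share exy xa yb ab.
case/or4P: (far z) => [/eqP ez|/eqP ez|zx|zy].
- by apply: sx; rewrite -ez.
- by apply: sy; rewrite -ez.
- by apply: sx; have [] := share (y := z) _ xa zb ab; rewrite 1?e_sym.
- by apply: sy; have [] := share (y := z) _ ya zb ab; rewrite 1?e_sym.
Qed.

(** The element [u] fixes or skewers [k]; in the second case [h], being fixed by [u], would cross
    [k]. *)
Lemma fix_step u z h k : commute u (f z) -> fixes u h -> sk z k -> ~~ cross h k -> fixes u k.
Proof.
move=> uz uh zk nc; have [//|uk] := commute_skewers (commute_sym uz) zk.
by rewrite (fix_cross uh uk) in nc.
Qed.

Definition power_word x y i m (b : bool) : word V := nseq i (x, true) ++ nseq m (y, b).

Lemma mem_power_word x y i m b l : l \in power_word x y i m b -> l.1 = x \/ l.1 = y.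
Proof. by rewrite mem_cat => /orP[]/nseqP[-> _]; [left|right]. Qed.

Lemma power_word_fix x y h : e x y -> sk y h ->
  exists i m b, 0 < i /\ fixes (ev f (power_word x y i m b)) h.
Proof.
move=> exy yh; have eyx : e y x by rewrite e_sym.
have [i [t [i0 [m tm] fh]]] := commensurable (f_comm eyx) yh.
case: tm fh => -> fh; [exists i, m, true|exists i, m, false]; split=> //;
  by rewrite ev_cat !ev_nseq ?expVgn.
Qed.

Lemma power_word_commute x y i m b z : commute (f x) (f z) -> commute (f y) (f z) ->
  commute (ev f (power_word x y i m b)) (f z).
Proof.
move=> xz yz; rewrite ev_cat !ev_nseq; apply: commute_sym; apply: commuteM.
  exact/commuteX/commute_sym.
apply: commuteX; case: b; first exact: commute_sym.
exact/commuteV/commute_sym.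
Qed.

(** A power word that fixes one wall of the block commutes with [f x] and [f y], so [fix_step] lets
    it fix the whole block. *)
Lemma spread_kill x y i : e x y -> sk x (ssval i) -> sk y (ssval i) ->
  (forall j, connect noncross i j -> sk x (ssval j) \/ sk y (ssval j)) ->
  exists n m b, 0 < n /\ ev (gpart (wblock i)) (power_word x y n m b) = 1.
Proof.
move=> exy xi yi all_xy; have [n [m [b [n0 fi]]]] := power_word_fix exy yi.
exists n, m, b; split=> //; apply: part_kill; first exact: block_sep.
move=> l h _ /node_of[j <-]; rewrite block_node; move: j {l h}.
have eyx : e y x by rewrite e_sym.
apply: (@connect_ind _ noncross (fun j => fixes _ (ssval j))) => // a c ia fa ac.
have [xc|yc] := all_xy c (connect_trans ia (connect1 ac)).
  apply: fix_step fa xc ac; apply: power_word_commute; last exact: f_comm.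
  exact: commute_refl.
apply: fix_step fa yc ac; apply: power_word_commute; first exact: f_comm.
exact: commute_refl.
Qed.

End Selection.

(** * Nontrivial words *)

Section RingTests.
Import GRing.Theory Num.Theory.
Local Open Scope ring_scope.

Lemma mul_nilpotent (R : pzRingType) (X : R) : X * X = 0 -> (1 + X) * (1 - X) = 1.
Proof. by move=> XX; rewrite mulrDl mul1r mulrBr mulr1 XX subr0 subrK. Qed.

Section RingEvaluation.
Variables (R : pzRingType) (V : finType) (e : rel V) (r : letter V -> R).
Hypothesis r_inv : forall v b, r (v, b) * r (v, ~~ b) = 1.
Hypothesis r_comm : forall a c, e a.1 c.1 -> r a * r c = r c * r a.
Implicit Type w : word V.

Definition rval w : R := \prod_(l <- w) r l.

Lemma rval_cat w w' : rval (w ++ w') = rval w * rval w'.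
Proof. exact: big_cat. Qed.

Lemma rval_requ w w' : raag_eq e w w' -> rval w = rval w'.
Proof.
elim=> [u v []|//|//|u y v _ -> _ -> //].
- by move=> u' v' x b; rewrite !rval_cat [rval [:: _; _]]big_cons big_seq1 r_inv mul1r.
- by move=> u' v' a c ac; rewrite !rval_cat ![rval [:: _; _]]big_cons !big_seq1 r_comm.
Qed.

Lemma rval_word_inv w : rval w * rval (word_inv w) = 1.
Proof.
elim: w => [|[v b] w IH]; first by rewrite /rval !big_nil mulr1.
rewrite /word_inv /= rev_cons -cats1 rval_cat -cat1s rval_cat !mulrA -[RHS](r_inv v b).
by rewrite -(mulrA (rval [:: _])) [rval w * _]IH mulr1 /rval !big_seq1.
Qed.

Lemma word_invK w : word_inv (word_inv w) = w.
Proof.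
rewrite /word_inv map_rev revK -map_comp map_id_in // => -[v b] _ /=.
by rewrite negbK.
Qed.

Lemma word_inv_cat w w' : word_inv (w ++ w') = word_inv w' ++ word_inv w.
Proof. by rewrite /word_inv map_cat rev_cat. Qed.

Lemma rval_word_inv' w : rval (word_inv w) * rval w = 1.
Proof. by rewrite -{2}[w]word_invK rval_word_inv. Qed.

Lemma rval_nseq n a : rval (nseq n a) = r a ^+ n.
Proof. by rewrite /rval big_nseq; elim: n => //= n ->; rewrite exprS. Qed.

Lemma rval_inv_nilpotent w X : X * X = 0 -> rval w = 1 + X -> rval (word_inv w) = 1 - X.
Proof.
move=> XX ew.
have : rval (word_inv w) * ((1 + X) * (1 - X)) = 1 - X.
  by rewrite mulrA -ew rval_word_inv' mul1r.
by rewrite mul_nilpotent // mulr1.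
Qed.

End RingEvaluation.

(** * Iterated commutators along a path, tested by unitriangular matrices *)

Section PathWord.
Variables (V : finType) (xs : nat -> V).

(** The iterated commutator of [xs 0 ^ N], [xs 1], up to [xs k]; the exponent [N] is chosen later to
    suit all blocks. *)
Fixpoint path_word N k : word V :=
  if k is k'.+1 then word_comm (path_word N k') [:: (xs k'.+1, true)]
  else nseq N (xs 0%N, true).

Variables (e : rel V) (n : nat) (Q : pred V) (idx : V -> nat).
Hypothesis Q_idx : forall x, Q x -> (idx x <= n)%N.
Hypothesis Q_adj : forall x y, e x y -> Q x -> Q y -> (idx y == (idx x).+1) = false /\
  (idx x == (idx y).+1) = false.
Hypothesis xsP : forall i, (i <= n)%N -> Q (xs i) /\ idx (xs i) = i.

Let M := 'M[int]_n.+2.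
Let E i j : M := delta_mx (inord i) (inord j).

Lemma E_mul i j k l : (j <= n.+1)%N -> (k <= n.+1)%N -> E i j * E k l = if j == k then E i l else 0.
Proof.
move=> jn kn; rewrite /E -mulmxE mul_delta_mx_cond -val_eqE /= !inordK //.
by case: eqP; rewrite ?mulr1n ?mulr0n.
Qed.

(** The vertex at position [i] goes to the transvection with entry [i, i + 1], and vertices outside
    [Q] to the identity. Transvections at non-consecutive positions commute. *)
Definition path_rep (l : letter V) : M :=
  if Q l.1 then if l.2 then 1 + E (idx l.1) (idx l.1).+1 else 1 - E (idx l.1) (idx l.1).+1
  else 1.

Lemma path_rep_inv v b : path_rep (v, b) * path_rep (v, ~~ b) = 1.
Proof.
rewrite /path_rep /=; case Qv: (Q v); last by rewrite mulr1.
have EE : E (idx v) (idx v).+1 * E (idx v) (idx v).+1 = 0.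
  by rewrite E_mul ?ltnS ?leqW ?Q_idx // eqn_leq ltnn.
case: b; first exact: mul_nilpotent.
by rewrite -{2}[E _ _]opprK mul_nilpotent // mulrNN.
Qed.

Lemma path_rep_comm a c : e a.1 c.1 -> path_rep a * path_rep c = path_rep c * path_rep a.
Proof.
move=> ac; rewrite /path_rep.
case Qa: (Q a.1); last by rewrite mulr1 mul1r.
case Qc: (Q c.1); last by rewrite mulr1 mul1r.
have [n1 n2] := Q_adj ac Qa Qc.
have EE : E (idx a.1) (idx a.1).+1 * E (idx c.1) (idx c.1).+1 = 0.
  by rewrite E_mul ?ltnS ?leqW ?Q_idx // eq_sym n1.
have EE' : E (idx c.1) (idx c.1).+1 * E (idx a.1) (idx a.1).+1 = 0.
  by rewrite E_mul ?ltnS ?leqW ?Q_idx // eq_sym n2.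
have com : GRing.comm (E (idx a.1) (idx a.1).+1) (E (idx c.1) (idx c.1).+1).
  by rewrite /GRing.comm EE EE'.
have com1 (X Y : M) b : GRing.comm X Y -> GRing.comm X (if b then 1 + Y else 1 - Y).
  by move=> XY; case: b; [apply: commrD|apply: commrB] => //; apply: commr1.
exact: (com1 _ _ c.2 (commr_sym (com1 _ _ a.2 (commr_sym com)))).
Qed.

Lemma path_word_rep N k : (k <= n)%N ->
  rval path_rep (path_word N k) = 1 + E 0 k.+1 *+ N.
Proof.
elim: k => [|k IH] kn.
  rewrite /= rval_nseq /path_rep /=; have [-> ->] := xsP kn.
  elim: N => [|N IHN]; first by rewrite expr0 mulr0n addr0.
  rewrite exprS IHN mulrDl mul1r mulrDr mulr1 mulrnAr E_mul // mul0rn addr0.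
  by rewrite mulrS -!addrA (addrC (E 0 1)).
have {}IH := IH (ltnW kn); set X := E 0 k.+1 *+ N in IH.
set w := [:: (xs k.+1, true)]; pose Y := E k.+1 k.+2.
have XX : X * X = 0 by rewrite mulrnAl mulrnAr E_mul // ?mul0rn // ltnW.
have YY : Y * Y = 0 by rewrite E_mul // ?eqn_leq ?ltnn // ltnW.
have YX : Y * X = 0 by rewrite mulrnAr E_mul // mul0rn.
have XY : X * Y = E 0 k.+2 *+ N by rewrite mulrnAl E_mul ?eqxx // ltnW.
have rw : rval path_rep w = 1 + Y.
  by rewrite /rval big_seq1 /path_rep /=; have [-> ->] := xsP kn.
rewrite [path_word _ _]/= !rval_cat.
rewrite (rval_inv_nilpotent path_rep_inv XX IH) (rval_inv_nilpotent path_rep_inv YY rw).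
rewrite IH rw -XY !mulrA -(mulrA _ (1 + X)).
have -> : (1 - X) * (1 - Y) = 1 - X - Y + X * Y.
  by rewrite mulrBl mul1r mulrBr mulr1 opprB addrA addrAC (addrAC 1 (- Y)).
have -> : (1 + X) * (1 + Y) = 1 + X + Y + X * Y.
  by rewrite mulrDl mul1r mulrDr mulr1 !addrA (addrAC 1 Y).
set P := X * Y.
have XP : X * P = 0 by rewrite /P mulrA XX mul0r.
have YP : Y * P = 0 by rewrite /P mulrA YX mul0r.
have PX : P * X = 0 by rewrite /P -mulrA YX mulr0.
have PY : P * Y = 0 by rewrite /P -mulrA YY mulr0.
have PP : P * P = 0 by rewrite {2}/P mulrA PX mul0r.
rewrite mulrDl !mulrBl mul1r !mulrDr !mulr1 XX YX YY XP YP PX PY PP !addr0.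
have -> : 1 + X + Y + P = 1 + Y + (X + P) by rewrite addrA (addrAC 1 X).
by rewrite -/P addrK addrK.
Qed.

Lemma path_word_neq1 N : (0 < N)%N -> ~ raag_eq e (path_word N n) [::].
Proof.
move=> N0 /(rval_requ path_rep_inv path_rep_comm); rewrite path_word_rep //.
rewrite /rval big_nil => /eqP; rewrite -subr_eq0 addrAC subrr add0r => /eqP.
move=> /matrixP/(_ (inord 0) (inord n.+1)); rewrite mulmxnE !mxE !eqxx /= => /eqP.
by rewrite pnatr_eq0; case: N N0.
Qed.

End PathWord.

(** * Iterated commutators for a path of three vertices *)

Section TripleWord.
Variables (V : finType) (e : rel V) (x y z : V).
Hypotheses (e_irr : irreflexive e) (xy : x != y) (xz : x != z) (yz : y != z).
Hypotheses (exy : ~~ e x y) (eyx : ~~ e y x) (eyz : ~~ e y z) (ezy : ~~ e z y).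

Let M := 'M[{poly int}]_2.
Let E : M := delta_mx 0 1.
Let F : M := delta_mx 1 0.

(** Both [x] and [z] become upper unitriangular and [y] lower. The indeterminate makes [x] and [z]
    independent, so that no [good_word] is sent to the identity. *)
Definition triple_rep (l : letter V) : M :=
  let sg (X : M) := if l.2 then 1 + X else 1 - X in
  if l.1 == x then sg E else if l.1 == z then sg ('X *: E) else
  if l.1 == y then sg F else 1.

Lemma scalE_nil (a b : {poly int}) : (a *: E) * (b *: E) = 0.
Proof. by rewrite -scalerAl -scalerAr /E -mulmxE mul_delta_mx_0 // !scaler0. Qed.

Lemma scalE_add (a b : {poly int}) : (1 + a *: E) * (1 + b *: E) = 1 + (a + b) *: E.
Proof.
by rewrite mulrDl mul1r mulrDr mulr1 scalE_nil addr0 scalerDl -!addrA (addrC (a *: E)).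
Qed.

Lemma triple_rep_inv v b : triple_rep (v, b) * triple_rep (v, ~~ b) = 1.
Proof.
have nil (X : M) c : X * X = 0 -> (if c then 1 + X else 1 - X) * (if ~~ c then 1 + X else 1 - X) = 1.
  move=> XX; case: c; first exact: mul_nilpotent.
  by rewrite -{2}[X]opprK mul_nilpotent // mulrNN.
rewrite /triple_rep /=; case: ifP => _; [|case: ifP => _; [|case: ifP => _]].
- by apply: nil; rewrite -[E]scale1r scalE_nil.
- by apply: nil; rewrite scalE_nil.
- by apply: nil; rewrite /F -mulmxE mul_delta_mx_0.
- by rewrite mulr1.
Qed.

Lemma triple_rep_comm a c : e a.1 c.1 -> triple_rep a * triple_rep c = triple_rep c * triple_rep a.
Proof.
case: a c => v b [w b'] /= vw; rewrite /triple_rep /=.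
have com (X Y : M) (d d' : bool) : X * Y = Y * X ->
    (if d then 1 + X else 1 - X) * (if d' then 1 + Y else 1 - Y) =
    (if d' then 1 + Y else 1 - Y) * (if d then 1 + X else 1 - X).
  have com1 (X' Y' : M) d1 : GRing.comm X' Y' -> GRing.comm X' (if d1 then 1 + Y' else 1 - Y').
    by move=> XY; case: d1; [apply: commrD|apply: commrB] => //; apply: commr1.
  by move=> XY; exact: (com1 _ _ d' (commr_sym (com1 _ _ d (commr_sym XY)))).
have EXE : E * ('X *: E) = 'X *: E * E.
  have h1 := scalE_nil 1 'X; have h2 := scalE_nil 'X 1.
  by rewrite !scale1r in h1 h2; rewrite h1 h2.
have [ev|nvx] := eqVneq v x; have [ew|nwx] := eqVneq w x; rewrite ?mul1r ?mulr1 //.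
- by rewrite ev ew e_irr in vw.
- have [ew|nwz] := eqVneq w z; first by rewrite com.
  have [ew|nwy] := eqVneq w y; last by rewrite mulr1 mul1r.
  by rewrite ev ew (negbTE exy) in vw.
- have [ev|nvz] := eqVneq v z; first by rewrite com.
  have [ev|nvy] := eqVneq v y; last by rewrite mulr1 mul1r.
  by rewrite ev ew (negbTE eyx) in vw.
have [ev|nvz] := eqVneq v z; have [ew'|nwz] := eqVneq w z.
- by rewrite ev ew' e_irr in vw.
- have [ew|nwy] := eqVneq w y; last by rewrite mulr1 mul1r.
  by rewrite ev ew (negbTE ezy) in vw.
- have [ev|nvy] := eqVneq v y; last by rewrite mulr1 mul1r.
  by rewrite ev ew' (negbTE eyz) in vw.
have [ev|nvy] := eqVneq v y; last by rewrite mulr1 mul1r.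
have [ew|nwy] := eqVneq w y; last by rewrite mulr1 mul1r.
by rewrite ev ew e_irr in vw.
Qed.

Definition triple_word (us : seq (word V)) : word V :=
  foldl (@word_comm V) [:: (y, true)] us.

Definition good_word (u : word V) : Prop := exists i m (b : bool), (0 < i + m)%N /\
  u = nseq i (x, true) ++ nseq m (z, b).

Lemma good_word_rep u : good_word u -> exists2 r : {poly int}, r != 0 & rval triple_rep u = 1 + r *: E.
Proof.
have pw (a : {poly int}) n : (1 + a *: E) ^+ n = 1 + (a *+ n) *: E.
  elim: n => [|n IH]; first by rewrite expr0 mulr0n scale0r addr0.
  by rewrite exprS IH scalE_add mulrS.
case=> i [m [b [im ->]]]; rewrite rval_cat !rval_nseq /triple_rep /= eqxx [z == x]eq_sym (negbTE xz) eqxx.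
have -> : (if b then 1 + 'X *: E else 1 - 'X *: E) = 1 + (if b then 'X else - 'X) *: E.
  by case: b; rewrite ?scaleNr.
rewrite -{1}[E]scale1r !pw scalE_add; eexists; last by [].
case: b; apply: contraTneq im => /polyP eq0; rewrite -eqn0Ngt addn_eq0;
  have := eq0 0%N; have := eq0 1%N;
  rewrite !coefD !coefMn ?coefN !coefX !coef1 !coef0 /= ?mul0rn ?add0r ?oppr0 ?mul0rn ?addr0.
- by move/eqP; rewrite pnatr_eq0 => -> /eqP; rewrite pnatr_eq0 => ->.
- by move/eqP; rewrite mulNrn oppr_eq0 pnatr_eq0 => -> /eqP; rewrite pnatr_eq0 => ->.
Qed.

(** The lower left entries of [w] and of its inverse stay nonzero together: for the commutator with
    a word of value [1 + r *: E] they become, up to sign, [r] times the product of the two former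
    entries. *)
Lemma triple_word_neq1 us : (forall u, u \in us -> good_word u) -> ~ raag_eq e (triple_word us) [::].
Proof.
move=> good /(rval_requ triple_rep_inv triple_rep_comm).
set rv := rval triple_rep; move=> eq1.
suff [/eqP//] : (rv (triple_word us)) 1 0 != 0 /\ (rv (word_inv (triple_word us))) 1 0 != 0.
  by rewrite eq1 /rv /rval big_nil mxE.
rewrite /triple_word {eq1}; elim/last_ind: us good => [|us u IH] good.
  have -> : word_inv [:: (y, true)] = [:: (y, false)] by [].
  rewrite /rv /rval /= !big_seq1 /triple_rep /= [y == x]eq_sym (negbTE xy) (negbTE yz) eqxx.
  by rewrite !mxE /= !add0r oppr_eq0 oner_eq0.
have [|n1 n2] := IH; first by move=> u' uu; apply: good; rewrite mem_rcons inE uu orbT.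
have [|r r0 ru] := @good_word_rep u; first by apply: good; rewrite mem_rcons mem_head.
rewrite -cats1 foldl_cat /=; move: (foldl _ _ us) n1 n2 => w n1 n2.
have riu : rv (word_inv u) = 1 - r *: E.
  by apply: (rval_inv_nilpotent triple_rep_inv) => //; apply: scalE_nil.
have rvc w1 w2 : rv (w1 ++ w2) = rv w1 * rv w2 by exact: rval_cat.
have WW : rv (word_inv w) * rv w = 1 := rval_word_inv' triple_rep_inv w.
pose K := rv (word_inv w) * E * rv w.
have K10 : K 1 0 = rv (word_inv w) 1 0 * rv w 1 0.
  rewrite /K -!mulmxE mxE big_ord_recl big_ord1 [X in X * _ + _]mxE [X in _ + X * _]mxE.
  rewrite !big_ord_recl !big_ord0 ![E _ _]mxE /= !mulr0 mulr1 !addr0 mul0r add0r.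
  by congr (rv _ _ _ * rv _ _ _); apply: val_inj.
have XE (X : M) : (X * E) 1 0 = 0.
  by rewrite -mulmxE mxE big_ord_recl big_ord1 !mxE /= !mulr0 addr0.
have EX (X : M) : (E * X) 1 0 = 0.
  by rewrite -mulmxE mxE big_ord_recl big_ord1 !mxE /= !mul0r addr0.
have conj (t : {poly int}) : rv (word_inv w) * (1 + t *: E) * rv w = 1 + t *: K.
  by rewrite mulrDr mulrDl mulr1 WW -scalerAr -scalerAl.
have K0 : K 1 0 != 0 by rewrite K10 mulf_neq0.
rewrite /word_comm !word_inv_cat !word_invK -!catA !rvc [rv u]ru riu.
have add10 (A B : M) : (A + B) 1 0 = A 1 0 + B 1 0 by rewrite mxE.
have scal10 t (A : M) : (t *: A) 1 0 = t * A 1 0 by rewrite mxE.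
have one10 : (1 : M) 1 0 = 0 by rewrite mxE.
split.
- rewrite !mulrA -scaleNr conj mulrDr mulr1 -scalerAr !add10 !scal10 XE mulr0 addr0 one10 add0r.
  by rewrite mulf_neq0 // oppr_eq0.
- rewrite (mulrA (rv (word_inv w))) conj.
  rewrite -scaleNr mulrDl mul1r -scalerAl !add10 !scal10 EX mulr0 addr0 one10 add0r.
  by rewrite mulf_neq0.
Qed.

End TripleWord.

End RingTests.

(** * Components of the complement *)

Section PathEval.
Variables (G : groupType) (V : finType) (f : V -> G) (xs : nat -> V).

Lemma ev_path_word_kill N k K : 0 < N -> k <= K -> f (xs k) = 1 -> ev f (path_word xs N K) = 1.
Proof.
move=> N0 kK fk; elim: K kK => [|K IH].
  rewrite leqn0 => /eqP k0; rewrite k0 in fk.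
  by rewrite /= ev_nseq fk expg1n.
rewrite leq_eqVlt => /orP[/eqP ek|]; first by rewrite /= ev_comm ev_seq1 -ek fk commg1.
by rewrite ltnS => /IH e; rewrite /= ev_comm e comm1g.
Qed.

Lemma ev_path_word_commute N K : 0 < K -> commute (f (xs 0) ^+ N) (f (xs 1)) ->
  ev f (path_word xs N K) = 1.
Proof.
case: K => // K _ c; elim: K => [|K IH].
  by rewrite /= ev_comm ev_nseq ev_seq1; apply/eqP/commgP.
by rewrite [path_word _ _ _]/= ev_comm [ev f (word_comm _ _)]IH comm1g.
Qed.

Lemma ev_triple_word_kill y u us : u \in us -> ev f u = 1 -> ev f (triple_word y us) = 1.
Proof.
move=> uu fu; elim/last_ind: us uu => [//|us u' IH].
rewrite mem_rcons inE /triple_word -cats1 foldl_cat /= ev_comm => /orP[/eqP<-|/IH].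
  by rewrite fu commg1.
by rewrite /triple_word => ->; rewrite comm1g.
Qed.

End PathEval.

Section Component.
Variable g : sgraph.
Local Notation G := (raag g).
Local Notation hs := (hs g).
Variables (V : finType) (e : rel V) (f : V -> G) (s : V -> seq hs).
Hypotheses (e_sym : symmetric e) (e_irr : irreflexive e).
Hypothesis f_comm : forall x y, e x y -> commute (f x) (f y).
Hypothesis f_gprod : forall x, f x = gprod (s x).
Hypothesis s_skew : forall x h, h \in s x -> skewers (f x) h.
Hypothesis f_inj : forall w, ev f w = 1 -> raag_eq e w [::].
Variables (Q : pred V) (xs : nat -> V) (n : nat) (idx : V -> nat).
Hypothesis Q_idx : forall x, Q x -> idx x < n /\ xs (idx x) = x.
Hypothesis xsP : forall i, i < n -> Q (xs i) /\ idx (xs i) = i.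
Hypothesis xs_e : forall i j, i < n -> j < n -> e (xs i) (xs j) = (i.+1 < j) || (j.+1 < i).
Hypothesis Q_out : forall x y, Q x -> ~~ Q y -> e x y.

Local Notation sk x h := (skewers (f x) h).
Local Notation node := (wnode s).
Local Notation ncr := (@noncross g V s).
Local Notation block := (@wblock g V s).
Local Notation part := (gpart s).
Implicit Types (i j k : nat) (a b c : node) (x y z : V).

(** Unmixed walls of different components cross: otherwise [skewers_share] would make a vertex of
    one component skewer the wall of the other. *)
Definition unmixed h := (forall y, ~~ Q y -> ~ sk y h) /\ exists2 y, Q y & sk y h.

Definition good_path (h : nat -> hs) :=
  (forall i, i < n -> unmixed (h i)) /\
  (forall i j, i < j -> j < n ->
    if j == i.+1 then cl (h i) * cl (h j) != cl (h j) * cl (h i) else cross (h i) (h j)).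

Lemma part_neq1 P x : part P x <> 1 -> exists2 h, h \in s x & P h.
Proof.
move=> ne; case: (boolP (has P (s x))) => [/hasP[h hx Ph]|/hasPn nP]; first by exists h.
case: ne; rewrite /gpart (_ : filter P (s x) = [::]) //.
by apply/eqP; rewrite -[_ == _]negbK -has_filter; apply/hasPn.
Qed.

Lemma part_block a b x : connect ncr a b -> part (block a) x = part (block b) x.
Proof.
move=> ab; rewrite /gpart; congr gprod; apply: eq_filter => h.
rewrite /wblock; case: insubP => // c _ _; apply/idP/idP => ac.
  exact: connect_block ab ac.
exact: connect_trans ab ac.
Qed.

Lemma part_node a x : part (block a) x <> 1 ->
  exists b, [/\ ssval b \in s x, sk x (ssval b) & connect ncr a b].
Proof.
move=> /part_neq1[h hx Ph]; have [b eb] := node_of hx.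
exists b; rewrite eb; split=> //; first exact: s_skew.
by rewrite -block_node eb.
Qed.

Lemma far_out x y : Q x -> ~~ Q y -> forall z, [|| z == x, z == y, e z x | e z y].
Proof.
move=> Qx Qy z; case: (boolP (Q z)) => Qz; last by rewrite (e_sym z x) Q_out ?orbT.
by rewrite (Q_out Qz Qy) !orbT.
Qed.

Lemma unmixed_block a b : connect ncr a b -> unmixed (ssval b) ->
  forall c, connect ncr a c -> unmixed (ssval c).
Proof.
move=> ab ub c ac; have bc := connect_block ab ac.
apply: (@connect_ind _ ncr (fun c => unmixed (ssval c))) bc => // {ac} {}c d _ [nc _] cd.
have [x _ xc] := wnode_own s_skew c.
have Qx : Q x by apply/negPn/negP => /nc.
have nd y : ~~ Q y -> ~ sk y (ssval d).
  move=> Qy yd; apply: (nc y Qy).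
  by have [] := share f_comm (Q_out Qx Qy) xc yd cd.
split=> //; have [y _ yd] := wnode_own s_skew d; exists y => //.
by apply/negPn/negP => /nd.
Qed.

(** Commuting walls that do not cross are parallel, and [m], crossing just one of the two, tells
    them apart. *)
Lemma ncr_cmt (h k m : hs) : ~~ cross h k -> cross h m -> ~~ cross k m ->
  cl h * cl k != cl k * cl h.
Proof.
move=> hk hm km; apply/negP => /eqP /commute_cl[hk'|[el par]]; first by rewrite hk' in hk.
case/negP: km; case/andP: hm => adj_hm /eqP c_hm; rewrite /cross -el adj_hm /=.
by apply/eqP; case: par c_hm => ->  // c; rewrite -[cl k]invgK; apply/commute_sym/commuteV/commute_sym.
Qed.

Lemma good_path_of_induced (c : nat -> node) m : 2 < n -> n <= m.+1 ->
  (forall i, i < m -> ncr (c i) (c i.+1)) ->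
  (forall i j, i.+1 < j -> j <= m -> ~~ ncr (c i) (c j)) ->
  (forall i, i <= m -> unmixed (ssval (c i))) ->
  good_path (fun i => ssval (c i)).
Proof.
move=> n2 nm cS cI cU; split=> [i lt_in|i j ij jn]; first by apply: cU; lia.
have cross_far i' j' : i'.+1 < j' -> j' <= m -> cross (ssval (c i')) (ssval (c j')).
  by move=> lt' le'; have := cI _ _ lt' le'; rewrite /noncross negbK.
case: eqP => [ej|nj]; last by apply: cross_far; lia.
rewrite {}ej in jn *.
have [lt|ge] := ltnP i.+2 n.
  apply: (@ncr_cmt _ _ (ssval (c i.+2))).
  - by apply: cS; lia.
  - by apply: cross_far; lia.
  - by apply: cS; lia.
case: i {ij} jn ge => [|i] jn ge; first lia.
rewrite eq_sym; apply: (@ncr_cmt _ _ (ssval (c i))).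
- by rewrite cross_sym; apply: cS; lia.
- by rewrite cross_sym; apply: cross_far; lia.
- by rewrite cross_sym; apply: cS; lia.
Qed.

Hypothesis n_gt1 : 1 < n.

Section NotThree.

Lemma block_path : exists a,
  (forall k, k < n -> part (block a) (xs k) <> 1) /\
  (forall m, 0 < m -> ~ commute (part (block a) (xs 0) ^+ m) (part (block a) (xs 1))).
Proof.
have [|F FP] := @fin_all_exists node (fun=> nat) (fun a N => 0 < N /\
    forall m, 0 < m -> commute (part (block a) (xs 0) ^+ m) (part (block a) (xs 1)) ->
    commute (part (block a) (xs 0) ^+ N) (part (block a) (xs 1))).
  move=> a; case: (classic (exists2 m, 0 < m &
    commute (part (block a) (xs 0) ^+ m) (part (block a) (xs 1)))) => [[m m0 c]|no].
    by exists m.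
  by exists 1%N; split=> // m m0 c; case: no; exists m.
(* [F a] is an exponent that makes the two parts commute in the block of [a], if there is one; the
   product works for all blocks at once. *)
pose N := (\prod_a F a)%N.
have N0 : 0 < N by apply: prodn_gt0 => a; case: (FP a).
apply: NNPP => none.
have := @path_word_neq1 V xs e n.-1 Q idx _ _ _ N N0; apply; rewrite ?prednK ?(ltnW n_gt1) //.
- by move=> x /Q_idx[]; lia.
- move=> x y exy /Q_idx[lx ex] /Q_idx[ly ey].
  by move: exy; rewrite -ex -ey xs_e // !(proj2 (xsP _)) //; lia.
- by move=> i le_i; apply: xsP; lia.
apply: f_inj; apply: (ev_blocks f_gprod) => a.
case: (classic (exists2 k, k < n & part (block a) (xs k) = 1)) => [[k kn pk]|nk].
  by apply: (@ev_path_word_kill _ _ _ _ _ k) => //; lia.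
apply: ev_path_word_commute; first lia.
case: (classic (exists2 m, 0 < m &
    commute (part (block a) (xs 0) ^+ m) (part (block a) (xs 1)))) => [[m m0 c]|nm].
  have [_ /(_ m m0 c) cF] := FP a.
  rewrite /N (bigD1 a) //= expgnA; apply: commute_sym; apply: commuteX.
  exact: commute_sym.
case: none; exists a; split=> [k kn pk|m m0 c]; first by apply: nk; exists k.
by apply: nm; exists m.
Qed.

Hypothesis n_neq3 : n != 3.

Lemma good_path_neq3 : exists h, good_path h.
Proof.
have [a [alive ncomm]] := block_path.
(* Otherwise [spread_kill] makes a positive power of [xs 0] agree in the block with a power of [y],
   which commutes with [xs 1]; this contradicts [ncomm]. *)
have only b y : connect ncr a b -> sk (xs 0) (ssval b) -> e (xs 0) y -> e (xs 1) y ->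
    (forall z, [|| z == xs 0, z == y, e z (xs 0) | e z y]) -> ~ sk y (ssval b).
  move=> ab xb e0y e1y far yb.
  have sp := spread e_sym f_comm s_skew e0y far xb yb.
  have [//|m [m' [d [m0]]]] := spread_kill e_sym f_comm f_gprod e0y xb yb.
    by move=> c /sp[]; left.
  rewrite ev_cat !ev_nseq -!(part_block _ ab) => /mulg1_eq e_inv.
  apply: (ncomm m m0); rewrite -[_ ^+ m]invgK e_inv.
  have c1y := part_commute f_comm f_gprod (@block_sep _ _ s a) e1y.
  apply/commute_sym/commuteV/commuteX; case: d {e_inv} => //; exact: commuteV.
have n0 := ltnW n_gt1.
have [b0 [s0 sk0 ab0]] := part_node (alive 0%N n0).
have [Q0 _] := xsP n0; have [Q1 _] := xsP n_gt1.
have ub0 : unmixed (ssval b0).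
  split=> [y Qy|]; last by exists (xs 0).
  apply: (only b0 y ab0 sk0); [exact: Q_out|exact: Q_out|exact: far_out].
have ub := unmixed_block ab0 ub0.
have [n2|n2] := leqP n 2.
  have {}n2 : n = 2%N by apply/eqP; rewrite eqn_leq n2.
  (* For two vertices no third wall is available for [ncr_cmt]; instead the parts themselves do not
     commute, so neither do some two of their conjugated letters. *)
  have [h [h' [hb kb nc]]] : exists (h h' : hs), [/\ unmixed h, unmixed h' & cl h * cl h' != cl h' * cl h].
    apply: NNPP => no; apply: (ncomm 1%N) => //; rewrite expg1.
    apply: commute_gprod => h h'; rewrite !mem_filter => /andP[Ph h0] /andP[Pk k1].
    apply/eqP/negPn/negP => nc; apply: no; exists h, h'; split=> //.
      by have [b eb] := node_of h0; rewrite -eb block_node in Ph; rewrite -eb; apply: ub.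
    by have [b eb] := node_of k1; rewrite -eb block_node in Pk; rewrite -eb; apply: ub.
  exists (fun i => if i == 0%N then h else h'); split=> [i _|i j ij jn]; first by case: eqP.
  by have [-> ->] : i = 0%N /\ j = 1%N by lia.
have n3 : 3 < n by rewrite ltn_neqAle eq_sym n_neq3.
have n1n : n.-1 < n by lia.
have [bn [sn skn abn]] := part_node (alive n.-1 n1n).
have [c [m [c0 cm cS cI]]] := induced_path (connect_block ab0 abn).
have ac k : k <= m -> connect ncr a (c k).
  elim: k => [|k IH] km; first by rewrite c0.
  exact: connect_trans (IH (ltnW km)) (connect1 (cS k km)).
have nm : n <= m.+1.
  (* The number [d] is the least distance from the end to a wall skewered by [xs 0]; [k0] is the
     position of that wall. *)
  have [|d [dm sk_d] min] := @least_nat (fun d => d <= m /\ sk (xs 0) (ssval (c (m - d)%N))) m.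
    by rewrite subnn c0.
  pose k0 := (m - d)%N; have k0m : k0 <= m by lia.
  have later k : k0 < k -> k <= m -> ~ sk (xs 0) (ssval (c k)).
    move=> kk km skk; have := min (m - k)%N; rewrite subKn // => /(_ (conj _ skk)); lia.
  have d0 : 0 < d.
    (* The assumption [3 < n] makes the last vertex adjacent to [xs 1], as [only] requires. *)
    rewrite lt0n; apply/eqP => d0; move: sk_d; rewrite d0 subn0 cm => sk0n.
    apply: (only bn (xs n.-1) abn sk0n _ _ _ skn); rewrite ?xs_e //; try lia.
    move=> z; case: (boolP (Q z)) => [/Q_idx[lz <-]|Qz]; last by rewrite (e_sym z) Q_out ?orbT.
    move: (idx z) lz => l ln; rewrite !xs_e //.
    case: (eqVneq l 0%N) => [->|l0]; first by rewrite eqxx.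
    case: (eqVneq l 1%N) => [->|l1]; last by rewrite (_ : (0.+1 < l)) ?orbT //; lia.
    by rewrite (_ : 2 < n.-1) ?orbT //; lia.
  (* Past [k0] the index of a skewering vertex grows by at most one per wall: a larger index is
     adjacent to an owner of the previous wall, so that [share] would already make it skewer that
     wall. *)
  have bound r : k0 + 1 + r <= m -> forall l, l < n -> sk (xs l) (ssval (c (k0 + 1 + r))) -> l <= 1 + r.
    elim: r => [|r IH] rm l ln skl; rewrite leqNgt; apply/negP => lt_l.
      rewrite addn0 in rm skl; apply: (later (k0 + 1)%N); [lia|exact: rm|].
      have e0l : e (xs 0) (xs l) by rewrite xs_e //; lia.
      by rewrite addn1 in skl rm *; have [] := share f_comm e0l sk_d skl (cS k0 rm).
    have rm' : k0 + 1 + r <= m by lia.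
    have [x _ skx] := wnode_own s_skew (c (k0 + 1 + r)).
    have [nx _] := ub _ (ac _ rm').
    have [lx ex] : idx x < n /\ xs (idx x) = x by apply: Q_idx; apply/negPn/negP => /nx.
    have := IH rm' (idx x) lx; rewrite ex => /(_ skx) le_x.
    have exl : e x (xs l) by rewrite -ex xs_e //; lia.
    have [|skl' _] := share f_comm exl skx skl.
      by have := cS (k0 + 1 + r); rewrite -addnS => /(_ rm).
    have := IH rm' l ln skl'; lia.
  have k0m' : k0 < m by rewrite /k0; lia.
  have := bound (m - k0 - 1)%N; have -> : (k0 + 1 + (m - k0 - 1) = m)%N by move: k0m'; clear; move: k0 => ?; lia.
  by move=> /(_ (leqnn m) n.-1 n1n); rewrite cm => /(_ skn); lia.
exists (fun i => ssval (c i)); apply: (good_path_of_induced (ltnW n3) nm cS cI).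
by move=> i im; apply/ub/ac.
Qed.

End NotThree.

Section Three.
Hypothesis n_eq3 : n = 3.

Let lt_i3 i : i < 3 -> i < n. Proof. by rewrite n_eq3. Qed.

(* A block may identify a power of [xs 0] with a power of [xs 2] in any ratio, so no
   fixed word dies on all such blocks: the test word takes commutators with one
   relation for each block. *)
Lemma block_triple : exists a, forall u, good_word (xs 0) (xs 2) u -> ev (part (block a)) u <> 1.
Proof.
have [|F FP] := @fin_all_exists node (fun=> word V) (fun a u => good_word (xs 0) (xs 2) u /\
    forall u', good_word (xs 0) (xs 2) u' -> ev (part (block a)) u' = 1 -> ev (part (block a)) u = 1).
  move=> a; case: (classic (exists2 u, good_word (xs 0) (xs 2) u & ev (part (block a)) u = 1)) => [[u gu u1]|no].
    by exists u.
  exists [:: (xs 0, true)]; split; first by exists 1%N, 0%N, true.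
  by move=> u gu u1; case: no; exists u.
apply: NNPP => none.
have xs_neq i j : i < n -> j < n -> i <> j -> xs i != xs j.
  move=> ri rj ij; apply/eqP => exs; apply: ij.
  by have [_ <-] := xsP ri; have [_ <-] := xsP rj; rewrite exs.
have := @triple_word_neq1 V e (xs 0) (xs 1) (xs 2) e_irr _ _ _ _ _ _ _ (codom F).
apply; rewrite ?xs_e ?xs_neq ?lt_i3 //.
  by move=> u /codomP[a ->]; case: (FP a).
apply: f_inj; apply: (ev_blocks f_gprod) => a.
apply: (@ev_triple_word_kill _ _ _ _ (F a)); first exact: codom_f.
have [_ kill] := FP a; apply: NNPP => no; apply: none; exists a => u gu u1.
by apply: no; apply: kill gu u1.
Qed.

Lemma good_path_3 : exists h, good_path h.
Proof.
have [a alive] := block_triple.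
have r0 := @lt_i3 0 isT; have r1 := n_gt1; have r2 := @lt_i3 2 isT.
have [Q0 _] := xsP r0; have [Q1 _] := xsP r1; have [Q2 _] := xsP r2.
have e02 : e (xs 0) (xs 2) by rewrite xs_e.
have e20 : e (xs 2) (xs 0) by rewrite e_sym.
have [b0 [s0 sk0 ab0]] : exists b, [/\ ssval b \in s (xs 0), sk (xs 0) (ssval b) & connect ncr a b].
  apply: part_node => p1; apply: (alive [:: (xs 0, true)]); first by exists 1%N, 0%N, true.
  by rewrite ev_seq1.
have [b2 [s2 sk2 ab2]] : exists b, [/\ ssval b \in s (xs 2), sk (xs 2) (ssval b) & connect ncr a b].
  apply: part_node => p1; apply: (alive [:: (xs 2, true)]); first by exists 0%N, 1%N, true.
  by rewrite ev_seq1.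
(* A power word fixing [b] cannot fix all walls of [xs 0] and [xs 2] in the block, since it would
   die there. *)
have kill b : sk (xs 2) (ssval b) ->
    (forall u, fixes u (ssval b) -> commute u (f (xs 0)) -> commute u (f (xs 2)) ->
     forall c, connect ncr a c -> ssval c \in s (xs 0) \/ ssval c \in s (xs 2) -> fixes u (ssval c)) -> False.
  move=> skb H; have [m [m' [d [m0 fb]]]] := power_word_fix e_sym f_comm e02 skb.
  apply: (alive (power_word (xs 0) (xs 2) m m' d)).
    by exists m, m', d; rewrite addn_gt0 m0.
  apply: (part_kill f_gprod); first exact: block_sep.
  move=> l h /mem_power_word lP hl; have [c ec] := node_of hl; rewrite -ec block_node => ac.
  apply: (H _ fb) => //.
  - by apply: power_word_commute; [exact: commute_refl|exact: f_comm].
  - by apply: power_word_commute; [exact: f_comm|exact: commute_refl].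
  - by rewrite ec; case: lP => <-; [left|right].
have ub0 : unmixed (ssval b0).
  split=> [y Qy yb|]; last by exists (xs 0).
  have sp := spread e_sym f_comm s_skew (Q_out Q0 Qy) (far_out Q0 Qy) sk0 yb.
  apply: (kill b2 sk2) => u fu u0 u2 c ac _.
  have b2c := connect_block ab2 ac.
  apply: (@connect_ind _ ncr (fun c => fixes u (ssval c))) b2c => // c' d b2c' fc' cd.
  have [|sk0d _] := sp d.
    by apply: connect_block ab0 _; apply: connect_trans ab2 (connect_trans b2c' (connect1 cd)).
  exact: fix_step u0 fc' sk0d cd.
have ub := unmixed_block ab0 ub0.
(* If no two walls of the block crossed, a power word fixing [b0] would fix all the walls in
   question by a single [fix_step] each. *)
have [b [b' [ab ab' cr]]] : exists b b', [/\ connect ncr a b, connect ncr a b' & cross (ssval b) (ssval b')].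
  apply: NNPP => no.
  have all_ncr b b' : connect ncr a b -> connect ncr a b' -> ~~ cross (ssval b) (ssval b').
    by move=> ab ab'; apply/negP => cr; apply: no; exists b, b'.
  have [sk20 _] := share f_comm e02 sk0 sk2 (all_ncr _ _ ab0 ab2).
  apply: (kill b0 sk20) => u fu u0 u2 c ac [] sc.
  - exact: fix_step u0 fu (s_skew sc) (all_ncr _ _ ab0 ac).
  - exact: fix_step u2 fu (s_skew sc) (all_ncr _ _ ab0 ac).
have [c [m [c0 cm cS cI]]] := induced_path (connect_block ab ab').
have ac k : k <= m -> connect ncr a (c k).
  elim: k => [|k IH] km; first by rewrite c0.
  exact: connect_trans (IH (ltnW km)) (connect1 (cS k km)).
(* The ends of the path cross, so they are neither equal nor consecutive. *)
have nm : n <= m.+1.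
  rewrite n_eq3; case: m cm cS {cI ac} => [|[|m]] // cm cS.
    by move: cr; rewrite -c0 cm cross_irr.
  by have := cS 0%N isT; rewrite /noncross c0 cm cr.
exists (fun i => ssval (c i)); apply: (good_path_of_induced r2 nm cS cI).
by move=> i im; apply/ub/ac.
Qed.

End Three.

Lemma exists_good_path : exists h, good_path h.
Proof.
by have [n3|n3] := eqVneq n 3; [exact: good_path_3|exact: good_path_neq3].
Qed.

End Component.

(** * Isolated vertices and conclusion *)

Section Exponent.
Import GRing.Theory Num.Theory.
Local Open Scope ring_scope.

(** The homomorphism to the positive rationals sending [z] to 2 and all other vertices to 1 detects
    the exponent of [z]. *)
Lemma exponent_neq1 (V : finType) (e : rel V) z i (v : word V) :
  (0 < i)%N -> (forall l, l \in v -> l.1 != z) ->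
  ~ raag_eq e (nseq i (z, true) ++ v) [::].
Proof.
move=> i0 vz; pose r (l : letter V) : rat := if l.1 == z then if l.2 then 2 else 2^-1 else 1.
move=> /(@rval_requ rat V e r) eq1.
have {eq1} : rval r (nseq i (z, true) ++ v) = 1.
  rewrite eq1 ?/rval ?big_nil // => [x b|a c _]; last exact: mulrC.
  by rewrite /r /=; case: eqP => _; case: b; rewrite ?mulr1 ?mulfV ?mulVf.
rewrite rval_cat rval_nseq [X in _ * X](_ : _ = 1) ?mulr1; last first.
  by rewrite /rval big1_seq // => l /andP[_ /vz]; rewrite /r => /negbTE->.
by rewrite /r /= eqxx => /eqP; rewrite pexpr_eq1.
Qed.

End Exponent.

(** * Elimination among isolated vertices *)

Section Isolated.
Variable g : sgraph.
Local Notation G := (raag g).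
Local Notation hs := (hs g).
Variables (V : finType) (e : rel V) (f : V -> G).
Hypothesis f_comm : forall x y, e x y -> commute (f x) (f y).
Hypothesis f_inj : forall w, ev f w = 1 -> raag_eq e w [::].
Implicit Types (z : V) (u v w : word V).

Lemma ev_commute w w' : (forall l l', l \in w -> l' \in w' -> commute (f l.1) (f l'.1)) ->
  commute (ev f w) (ev f w').
Proof.
have sg (x y : G) b : commute x y -> commute x (if b then y else y^-1).
  by case: b => // /commuteV.
elim: w => [|l w IH] c /=; first exact: (commute_sym (commute1 _)).
apply: commute_sym; apply: commuteM; last first.
  by apply/commute_sym/IH => l1 l' lw; apply: c; rewrite inE lw orbT.
apply: (sg); have {}c l' : l' \in w' -> commute (f l'.1) (f l.1).
  by move=> lw'; apply/commute_sym/c => //; exact: mem_head.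
elim: w' c {IH} => [|l' w' IH] c /=; first exact: (commute_sym (commute1 _)).
apply: commute_sym; apply: commuteM.
  by apply/sg/commute_sym/c/mem_head.
by apply/commute_sym/IH => l1 lw; apply: c; rewrite inE lw orbT.
Qed.

Lemma fixesX (t : G) n k : fixes t k -> fixes (t ^+ n) k.
Proof. by move=> ft; elim: n => [|n IH]; rewrite ?expg0 ?expgS; [exact: fixes1|exact: fixesM]. Qed.

Lemma zpow_word w t : zpow (ev f w) t ->
  exists2 w', ev f w' = t & forall l, l \in w' -> exists2 l', l' \in w & l'.1 = l.1.
Proof.
have evX n v : ev f (flatten (nseq n v)) = ev f v ^+ n.
  by elim: n => //= n IH; rewrite ev_cat IH expgS.
have mem n v l : l \in flatten (nseq n v) -> l \in v.
  by case/flattenP => v' /nseqP[-> _].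
case=> n [->|->]; first by exists (flatten (nseq n w)) => // l /mem lw; exists l.
exists (flatten (nseq n (word_inv w))); first by rewrite evX ev_inv expVgn.
move=> l /mem; rewrite /word_inv mem_rev => /mapP[l' lw ->].
by exists l'.
Qed.

(* Elimination: for mutually commuting independent elements, each new one is
   multiplied by powers of the former elements until it fixes the walls already
   chosen, and contributes one wall that it skewers. *)
Lemma isolated_walls (h0 : hs) (zs : seq V) : uniq zs ->
  {in zs &, forall z z', z != z' -> e z z'} ->
  exists (h : V -> hs) (u : V -> word V),
    [/\ forall z l, z \in zs -> l \in u z -> l.1 \in zs,
        forall z, z \in zs -> skewers (ev f (u z)) (h z),
        {in zs &, forall z z', z != z' -> cross (h z) (h z')} &
        forall s1 z s2, zs = s1 ++ z :: s2 -> forall z', z' \in s2 -> fixes (ev f (u z)) (h z')].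
Proof.
elim: zs => [|z zs IH] /=.
  by move=> _ _; exists (fun=> h0), (fun=> [::]); split=> // -[].
move=> /andP[nz uz] ezs; have [|h [u [u_in u_sk h_cr u_fix]]] := IH uz.
  by move=> a b az bz; apply: ezs; rewrite inE ?az ?bz orbT.
have comm a b : a \in z :: zs -> b \in z :: zs -> commute (f a) (f b).
  by move=> az bz; case: (eqVneq a b) => [->|ab]; [exact: commute_refl|exact/f_comm/ezs].
have inS a : a \in zs -> a \in z :: zs by rewrite inE orbC => ->.
have [i [v [i0 v_in v_fix]]] : exists i v, [/\ 0 < i, forall l, l \in v -> l.1 \in zs &
    forall z', z' \in zs -> fixes (f z ^+ i * ev f v) (h z')].
  (* The corrections run from the end of [zs] to its front: [u z'] fixes the walls of the vertices
     after [z'], so the later corrections spoil no earlier one. *)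
  suff H r s1 : zs = s1 ++ r -> exists i v, [/\ 0 < i, forall l, l \in v -> l.1 \in zs &
      forall z', z' \in r -> fixes (f z ^+ i * ev f v) (h z')] by exact: (H zs [::]).
  elim: r s1 => [|z' r IHr] s1 ezs1; first by exists 1%N, [::].
  have [|i [v [i0 v_in v_fix]]] := IHr (rcons s1 z'); first by rewrite cat_rcons.
  have z'zs : z' \in zs by rewrite ezs1 mem_cat mem_head orbT.
  set y := f z ^+ i * ev f v.
  have ey : y = ev f (nseq i (z, true) ++ v) by rewrite ev_cat ev_nseq.
  have [|j [t' [j0 tt fx]]] := @commensurable _ (ev f (u z')) y (h z') _ (u_sk _ z'zs).
    rewrite ey; apply: ev_commute => l l' lu; rewrite mem_cat => lv.
    apply: comm; first exact/inS/(u_in z').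
    by case/orP: lv => [/nseqP[-> _]|/v_in/inS //]; exact: mem_head.
  have [w' ew w_in] := zpow_word tt.
  exists (i * j)%N, (flatten (nseq j v) ++ w'); split; first by rewrite muln_gt0 i0.
    move=> l; rewrite mem_cat => /orP[/flattenP[v' /nseqP[-> _]]|/w_in[l' lu <-]]; first exact: v_in.
    exact: u_in lu.
  have -> : f z ^+ (i * j) * ev f (flatten (nseq j v) ++ w') = y ^+ j * t'.
    rewrite ev_cat ew mulgA expgnA /y expgMn; last first.
      rewrite -(ev_nseq f z true); apply: ev_commute => l l' /nseqP[-> _] /v_in lz.
      by apply: comm; rewrite ?mem_head ?inS.
    by congr (_ * _ * _); elim: j {j0 fx} => //= j IHj; rewrite ev_cat IHj expgS.
  move=> a; rewrite inE => /orP[/eqP->|ar]; first exact: fx.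
  apply: fixesM; first exact/fixesX/v_fix.
  have fu := u_fix _ _ _ ezs1 a ar.
  by case: tt => m [->|->]; [|apply: fixesV]; apply: fixesX.
pose w := nseq i (z, true) ++ v.
have ew : ev f w = f z ^+ i * ev f v by rewrite ev_cat ev_nseq.
have [k sk_k] : exists k, skewers (ev f w) k.
  apply: NNPP => no; apply: (@exponent_neq1 _ e z i v i0) => [l /v_in lz|].
    by apply: contraNneq nz => <-.
  by apply/f_inj/skewers_nonempty => k sk; apply: no; exists k.
have nzE a : a \in zs -> (a == z) = false by move=> az; apply: contraNF nz => /eqP <-.
have cr_k a : a \in zs -> cross (h a) k by move=> az; apply: fix_cross sk_k; rewrite ew; exact: v_fix.
exists (fun a => if a == z then k else h a), (fun a => if a == z then w else u a); split.
- move=> a l; rewrite inE; case: eqP => [_ _|_ /= az lu]; last exact/inS/(u_in a).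
  by rewrite mem_cat => /orP[/nseqP[-> _]|/v_in/inS //]; exact: mem_head.
- by move=> a; rewrite inE; case: eqP => // _ /u_sk.
- move=> a b; rewrite !inE; case: eqP => [->|na] /=; case: eqP => [->|nb] //= az bz ab.
  + by rewrite eqxx in ab.
  + by rewrite cross_sym; apply: cr_k.
  + exact: cr_k.
  + exact: h_cr.
- case=> [|b s1] a s2 /= [].
    by move=> <- <- a' az; rewrite eqxx (nzE _ az) ew; apply: v_fix.
  move=> _ ezs2 a' as2; have az : a \in zs by rewrite ezs2 mem_cat mem_head orbT.
  have az' : a' \in zs by rewrite ezs2 mem_cat inE as2 !orbT.
  by rewrite (nzE _ az) (nzE _ az'); apply: u_fix ezs2 _ as2.
Qed.

End Isolated.

(** * Joining the walls of all components *)

Section Assembly.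
Variables (V : finType) (g : sgraph) (e : rel V) (f : V -> raag g) (comp pos : V -> nat).
Local Notation hs := (hs g).
Hypotheses (e_sym : symmetric e) (e_irr : irreflexive e).
Hypothesis comp_pos_inj : forall x y, comp x = comp y -> pos x = pos y -> x = y.
Hypothesis pos_pred : forall x, 0 < pos x -> exists y, comp y = comp x /\ pos y = (pos x).-1.
Hypothesis eE : forall x y, x != y ->
  ~~ e x y = (comp x == comp y) && ((pos x == (pos y).+1) || (pos y == (pos x).+1)).
Hypothesis f_comm : forall x y, e x y -> commute (f x) (f y).
Hypothesis f_inj : forall w, ev f w = 1 -> raag_eq e w [::].
Implicit Types (x y z : V).

Let Q x := [pred y | comp y == comp x].
Let size_of x := \max_(y in Q x) (pos y).+1.

Lemma pos_lt x y : comp y = comp x -> pos y < size_of x.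
Proof. by move=> c; apply: (@leq_bigmax_cond _ _ (fun y => (pos y).+1)); rewrite inE c. Qed.

Lemma pos_fill x i : i < size_of x -> exists y, comp y = comp x /\ pos y = i.
Proof.
have [|y Qy] := @eq_bigmax_cond V (Q x) (fun y => (pos y).+1).
  by apply/card_gt0P; exists x; rewrite !inE /= eqxx.
rewrite /size_of => ->.
rewrite ltnS => iy; rewrite -(subKn iy); elim: (pos y - i)%N => [|d [z [cz pz]]].
  by exists y; rewrite subn0; split=> //; apply/eqP.
case: (posnP (pos z)) => [z0|z0].
  by exists z; split=> //; lia.
by have [t [ct pt]] := pos_pred z0; exists t; rewrite ct cz pt pz; split=> //; lia.
Qed.

Lemma e_comp x y : comp x != comp y -> e x y.
Proof.
move=> cxy; apply/negPn; rewrite eE ?(negbTE cxy) //.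
by apply: contraNneq cxy => ->.
Qed.

Lemma hs_inhabited x : exists h : hs, skewers (f x) h.
Proof.
apply: NNPP => no; apply: (@exponent_neq1 _ e x 1 [::]) => //.
apply: f_inj; rewrite ev_cat ev_nseq /= expg1 mulg1; apply: skewers_nonempty => h sk.
by apply: no; exists h.
Qed.

Lemma component_path (s : V -> seq hs) x :
  (forall z, f z = gprod (s z)) -> (forall z h, h \in s z -> skewers (f z) h) ->
  1 < size_of x -> exists h : nat -> hs, good_path f (Q x) (size_of x) h.
Proof.
move=> f_gprod s_skew n1.
pose xs i := odflt x [pick y | (comp y == comp x) && (pos y == i)].
have xsP i : i < size_of x -> comp (xs i) = comp x /\ pos (xs i) = i.
  move=> /pos_fill[y [cy py]]; rewrite /xs; case: pickP => [z /andP[/eqP cz /eqP pz] //|/(_ y)].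
  by rewrite cy py !eqxx.
apply: (@exists_good_path g V e f s e_sym e_irr f_comm f_gprod s_skew f_inj (Q x) xs _ pos) => //.
- move=> y /eqP cy; split; first exact: pos_lt.
  have [cxs pxs] := xsP _ (pos_lt cy).
  by apply: comp_pos_inj => //; rewrite cxs.
- by move=> i /xsP[c p]; split=> //; apply/eqP.
- move=> i j /xsP[ci pi] /xsP[cj pj]; have [eij|nij] := eqVneq (xs i) (xs j).
    have -> : i = j by rewrite -pi eij.
    by rewrite e_irr ltnNge leqnSn.
  have nij' : i != j by apply: contraNneq nij => ->.
  by apply: negb_inj; rewrite eE // ci cj pi pj eqxx /=; lia.
- by move=> y z /eqP cy /eqP cz; apply: e_comp; rewrite cy eq_sym; apply/eqP.
Qed.

Lemma isolated_e z x : size_of z <= 1 -> x != z -> e z x.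
Proof.
move=> nz xz; have zx : z != x by rewrite eq_sym.
apply/negPn; rewrite eE //; apply/negP => /andP[/eqP c p].
have := leq_trans (pos_lt (esym c)) nz; have := leq_trans (@pos_lt z z erefl) nz.
by rewrite !ltnS !leqn0 => /eqP pz /eqP px; rewrite pz px in p.
Qed.

Lemma wall_system : exists h : V -> hs, forall x y, x != y -> rel_ok (e x y) (h x) (h y).
Proof.
have [|s sP] := @fin_all_exists V (fun=> seq hs)
    (fun z s => f z = gprod s /\ forall h, h \in s -> skewers (f z) h).
  by move=> z; have [s] := skewered_product (f z); exists s.
have f_gprod z : f z = gprod (s z) by case: (sP z).
have s_skew z h : h \in s z -> skewers (f z) h by case: (sP z) => _; apply.
have [|H HP] := @fin_all_exists V (fun=> nat -> hs)
    (fun x h => 1 < size_of x -> good_path f (Q x) (size_of x) h).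
  move=> x; have [n1|n1] := ltnP 1 (size_of x); last first.
    by have [h _] := hs_inhabited x; exists (fun=> h) => n1'; lia.
  by have [h hP] := component_path f_gprod s_skew n1; exists h.
(* All vertices of a component must use the path of walls chosen for one representative. *)
pose r x := odflt x [pick y | comp y == comp x].
have rP x : comp (r x) = comp x.
  by rewrite /r; case: pickP => [y /eqP|].
have r_eq x y : comp x = comp y -> r x = r y.
  rewrite /r => c; rewrite (eq_pick (Q := fun z => comp z == comp y)) => [|z]; last by rewrite c.
  by case: pickP => // /(_ y); rewrite eqxx.
have size_r x : size_of (r x) = size_of x by apply: eq_bigl => z; rewrite !inE rP.
pose zs := [seq z <- enum V | size_of z <= 1].
have mem_zs z : (z \in zs) = (size_of z <= 1) by rewrite mem_filter mem_enum andbT.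
(* Without vertices there may be no halfspace at all, so the empty case is separate. *)
have [x0 _|V0] := pickP (fun _ : V => true); last first.
  by exists (fun x => False_rect _ (Bool.diff_true_false (V0 x))) => x; have := V0 x.
have [h0 _] := hs_inhabited x0.
have [|z z' zz z'z zz'|hz [u [u_in u_sk hz_cr _]]] := isolated_walls f_comm f_inj h0 (zs := zs).
- exact/filter_uniq/enum_uniq.
- by apply: isolated_e; rewrite -?mem_zs // eq_sym.
pose h x := if size_of x <= 1 then hz x else H (r x) (pos x).
have big x : 1 < size_of x -> unmixed f (Q x) (h x).
  move=> n1; have [|+ _] := HP (r x); rewrite size_r // => /(_ (pos x) (pos_lt erefl)).
  by rewrite /h leqNgt n1 /unmixed /= rP.
(* The letters of [u z] lie outside the component of [x]. They commute with a vertex skewering the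
   unmixed wall [h x] and do not skewer it, hence fix it; so [u z] fixes [h x] while it skewers
   [h z]. *)
have big_small x z : 1 < size_of x -> size_of z <= 1 -> cross (h x) (h z).
  move=> n1 nz; have [out [y Qy sk_y]] := big x n1.
  have zz : z \in zs by rewrite mem_zs.
  rewrite [h z]/h nz; apply: (fix_cross _ (u_sk z zz)); apply: fixes_ev => l lu.
  have := u_in z l zz lu; rewrite mem_zs => nl.
  have Ql : ~~ Q x l.1.
    apply: contraTN nl => /eqP c; rewrite -ltnNge.
    by rewrite (_ : size_of l.1 = size_of x) //; apply: eq_bigl => t; rewrite !inE c.
  have ely : e l.1 y by apply: e_comp; rewrite (eqP Qy).
  have [//|sk_l] := commute_skewers (commute_sym (f_comm ely)) sk_y.
  by case: (out l.1 Ql).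
have big_big x y : 1 < size_of x -> 1 < size_of y -> comp x != comp y -> cross (h x) (h y).
  move=> nx ny cxy; have [outx [x' Qx sk_x]] := big x nx; have [_ [y' Qy sk_y]] := big y ny.
  have ne : ~~ Q x y' by rewrite /= (eqP Qy) eq_sym.
  apply/negPn/negP => nc; apply: (outx y' ne).
  have exy : e x' y' by apply: e_comp; rewrite (eqP Qx) (eqP Qy).
  by have [] := skewers_share (f_comm exy) sk_x sk_y nc.
exists h => x y; have wl x' y' : comp x' = comp y' -> pos x' < pos y' -> rel_ok (e x' y') (h x') (h y').
  move=> c lt; have n1 : 1 < size_of x' by apply: leq_ltn_trans (pos_lt (esym c)); apply: leq_ltn_trans lt.
  have n1' : 1 < size_of y' by apply: leq_ltn_trans (pos_lt erefl); apply: leq_ltn_trans lt.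
  have [|_ +] := HP (r x'); rewrite size_r // => /(_ (pos x') (pos y') lt (pos_lt (esym c))).
  have -> : H (r x') (pos x') = h x' by rewrite /h leqNgt n1.
  have -> : H (r x') (pos y') = h y' by rewrite (r_eq _ _ c) /h leqNgt n1'.
  have ne : x' != y' by apply: contraTneq lt => ->; rewrite ltnn.
  have := eE ne; rewrite c eqxx /rel_ok /=; case: (eqVneq (pos y') (pos x').+1) => [_|np].
    by rewrite orbT => /negbTE->.
  by rewrite orbF [pos x' == _](_ : _ = false) => [/negbFE->|]; last lia.
move=> xy; have [c|nc] := eqVneq (comp x) (comp y).
  have [lt|lt|p] := ltngtP (pos x) (pos y); first exact: wl.
    by rewrite rel_ok_sym e_sym; apply: wl.
  by case/eqP: xy; apply: comp_pos_inj.
rewrite /rel_ok e_comp //; have [nx|nx] := leqP (size_of x) 1; have [ny|ny] := leqP (size_of y) 1.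
- by rewrite /h nx ny; apply: hz_cr; rewrite ?mem_zs.
- by rewrite cross_sym; apply: big_small.
- exact: big_small.
- exact: big_big.
Qed.

End Assembly.

Theorem theorem1p1 (VL VG : finType) (eL : rel VL) (eG : rel VG) :
  simple_graph eL -> simple_graph eG ->
  linear_forest (compl_rel eL) ->
  raag_embeds eL eG ->
  full_subgraph eL eG.
Proof.
move=> [eL_sym eL_irr] [eG_sym eG_irr] [comp [pos [inj [pred_pos edges]]]] [gm [hom inj_hom]].
pose g := SGraph eG_sym eG_irr.
pose f x : raag g := cls (gm x : word g).
have cp_inj x y : comp x = comp y -> pos x = pos y -> x = y by move=> c p; apply: inj; rewrite c p.
have pp x : 0 < pos x -> exists y, comp y = comp x /\ pos y = (pos x).-1 by exact: pred_pos.
have eE x y : x != y ->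
    ~~ eL x y = (comp x == comp y) && ((pos x == (pos y).+1) || (pos y == (pos x).+1)).
  by move=> xy; rewrite -edges /compl_rel xy.
have f_comm x y : eL x y -> commute (f x) (f y).
  by move=> /hom h; rewrite /commute -!(@clsM g); apply/clsP.
have f_inj w : ev f w = 1 -> raag_eq eL w [::].
  by rewrite -(@cls_subst g) => /clsP; exact: (inj_hom w [::]).
have [h hP] := wall_system eL_sym eL_irr cp_inj pp eE f_comm f_inj.
have [m [m_inj mP]] := conf_embedding eL_sym eL_irr cp_inj pp eE hP.
by exists m.
Qed.
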